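(* Let $k\ge3$. There exist $k-1$ Short $\mathbb{C}^k$'s $\Omega_1,\dots,\Omega_{k-1}\subset\mathbb{C}^k$ such that $\Omega_i\cap\Omega_j=\emptyset$ for all $i\ne j$.
   Context: A Short $\mathbb{C}^k$ is a domain $\Omega\subset\mathbb{C}^k$ such that: (1) $\Omega=\bigcup_{j\ge1}\Omega_j$ with $\Omega_j\subset\Omega_{j+1}$ and each $\Omega_j$ biholomorphic to the unit ball of $\mathbb{C}^k$; (2) the infinitesimal Kobayashi pseudometric of $\Omega$ vanishes identically; (3) $\Omega$ carries a non-constant plurisubharmonic function that is bounded above (in particular $\Omega$ is not biholomorphic to $\mathbb{C}^k$). *)

(* Defs.v *)
From HB Require Import structures.
From mathcomp Require Import all_boot all_order all_algebra.
From mathcomp Require Import all_classical all_reals all_analysis.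
From mathcomp Require Import complex.
Set Implicit Arguments. Unset Strict Implicit. Unset Printing Implicit Defensive.
Import Order.TTheory GRing.Theory Num.Theory.
Local Open Scope classical_set_scope.
Local Open Scope ring_scope.

Section ShortCk.
Variable R : realType.

Definition cabs (z : R[i]) : R :=
  Num.sqrt (complex.Re z ^+ 2 + complex.Im z ^+ 2).

Definition vnorm (n : nat) (z : 'rV[R[i]]_n) : R :=
  Num.sqrt (\sum_(j < n) cabs (z ord0 j) ^+ 2).

Definition unit_ball (n : nat) : set 'rV[R[i]]_n := [set z | vnorm z < 1].

Definition copen (n : nat) (U : set 'rV[R[i]]_n) : Prop :=
  forall z, U z -> exists2 r : R, 0 < r & forall w, vnorm (w - z) < r -> U w.

Definition cconnected (n : nat) (U : set 'rV[R[i]]_n) : Prop :=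
  forall A B : set 'rV[R[i]]_n, copen A -> copen B ->
    U `<=` A `|` B -> U `&` A `&` B = set0 ->
    U `<=` A \/ U `<=` B.

Definition cdomain (n : nat) (U : set 'rV[R[i]]_n) : Prop :=
  copen U /\ cconnected U /\ U !=set0.

Definition hasCderiv (n m : nat) (f : 'rV[R[i]]_n -> 'rV[R[i]]_m)
    (z : 'rV[R[i]]_n) (L : 'M[R[i]]_(n, m)) : Prop :=
  forall eps : R, 0 < eps -> exists2 d : R, 0 < d &
    forall h : 'rV[R[i]]_n, vnorm h < d ->
      vnorm (f (z + h) - f z - h *m L) <= eps * vnorm h.

Definition holomorphic (n m : nat) (U : set 'rV[R[i]]_n)
    (f : 'rV[R[i]]_n -> 'rV[R[i]]_m) : Prop :=
  forall z, U z -> exists L : 'M[R[i]]_(n, m), hasCderiv f z L.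

Definition biholomorphic (n : nat) (U V : set 'rV[R[i]]_n) : Prop :=
  copen U /\ copen V /\
  exists (f g : 'rV[R[i]]_n -> 'rV[R[i]]_n),
    holomorphic U f /\ holomorphic V g /\
    (forall z, U z -> V (f z) /\ g (f z) = z) /\
    (forall w, V w -> U (g w) /\ f (g w) = w).

Definition kobayashi (n : nat) (Om : set 'rV[R[i]]_n)
    (z v : 'rV[R[i]]_n) : \bar R :=
  ereal_inf [set (r^-1)%:E | r in
    [set r : R | 0 < r /\
      exists f : 'rV[R[i]]_1 -> 'rV[R[i]]_n,
        holomorphic (@unit_ball 1) f /\
        f @` (@unit_ball 1) `<=` Om /\
        f 0 = z /\ hasCderiv f 0 ((r%:C)%C *: v)]].

Definition expi (t : R) : R[i] := (cos t +i* sin t)%C.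

(** plurisubharmonic functions on Om with values in [-oo, +oo):
    upper semicontinuous and subharmonic on every complex line, i.e.
    sub-mean-value property on every closed complex disc in Om *)
Definition psh (n : nat) (Om : set 'rV[R[i]]_n)
    (u : 'rV[R[i]]_n -> \bar R) : Prop :=
  (forall z, Om z -> (u z < +oo)%E) /\
  (forall z, Om z -> forall c : R, (u z < c%:E)%E ->
     exists2 d : R, 0 < d &
       forall w, Om w -> vnorm (w - z) < d -> (u w < c%:E)%E) /\
  (forall a b : 'rV[R[i]]_n,
     (forall zeta : R[i], cabs zeta <= 1 -> Om (a + zeta *: b)) ->
     (u a <= ((2 * pi)^-1)%R%:E *
        \int[@lebesgue_measure R]_(t in `[0%R, (2 * pi)%R]) u (a + expi t *: b)%R)%E).

Definition short_C (k : nat) (Om : set 'rV[R[i]]_k) : Prop :=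
  cdomain Om /\
  (exists Oms : nat -> set 'rV[R[i]]_k,
     (forall j, Oms j `<=` Oms j.+1) /\
     Om = \bigcup_j Oms j /\
     (forall j, biholomorphic (Oms j) (@unit_ball k))) /\
  (forall z v, Om z -> kobayashi Om z v = 0%E) /\
  (exists u : 'rV[R[i]]_k -> \bar R,
     psh Om u /\
     (exists M : R, forall z, Om z -> (u z <= M%:E)%E) /\
     (exists z w, Om z /\ Om w /\ u z <> u w)).

End ShortCk.

(* Main.v *)
Require Import Defs.
From HB Require Import structures.
From mathcomp Require Import all_boot all_order all_algebra.
From mathcomp Require Import all_classical all_reals all_analysis.
From mathcomp Require Import complex ring lra perm separable cyclotomic.
Set Implicit Arguments. Unset Strict Implicit. Unset Printing Implicit Defensive.
Import Order.TTheory GRing.Theory Num.Theory.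
Import numFieldNormedType.Exports.
Local Open Scope classical_set_scope.
Local Open Scope ring_scope.

(** Let m = k - 1 and q(w) = w (m + 1 - w^m) / m.  Every m-th root of unity p is
    a superattracting fixed point of q: q(p) = p, q'(p) = 0, q''(p) <> 0.
    Compose the automorphisms
      F_j (z_0, z_1, z_2, ..) = (q(z_0) + eta_j z_1, eta_j z_0, eta_j z_2, ..)
    of C^k, where eta_j > 0 decreases like delta^(2^(j+1)).  For a small r each
    F_j maps the ball B(p e_0, r) into the ball of half the radius and contracts
    derivatives there by 1/2.  Hence the set of points whose orbit enters
    B(p e_0, r) is an increasing union of preimages of balls, its Kobayashi
    metric vanishes, and the sets belonging to distinct p are disjoint.
    With x_j the distance in the first coordinate between the j-th orbit point
    and p e_0, the functions 2^-j log max(x_j, delta^(2^j)) are plurisubharmonic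
    on C^k and converge geometrically on each of these sets, because
    x_(j+1) is comparable to x_j^2 up to an error eta_j.  The limit is bounded
    above, and it is nonconstant if delta is small.

    The mean value inequality for log max(|P|, d), P a polynomial, reduces to
    that of t |-> log |e^(it) - a| with |a| <> 1.  The integral I(a) of the latter
    over [0, 2 pi] satisfies I(a^2) = 2 I(a), so it equals 2^-n I(a^(2^n)), which
    is estimated by the trivial lower bound | |a|^(2^n) - 1 | of the integrand. *)

(** * Norms and complex derivatives *)

Section Norms.
Variable R : realType.
Implicit Types (z w : R[i]) (r : R).

Lemma cabsE z : cabs z = ComplexField.Normc.normc z.
Proof. by case: z. Qed.

Lemma cabs_ge0 z : 0 <= cabs z. Proof. exact: sqrtr_ge0. Qed.

Lemma cabs0 : cabs (0 : R[i]) = 0.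
Proof. by rewrite cabsE ComplexField.Normc.normc0. Qed.

Lemma cabs1 : cabs (1 : R[i]) = 1.
Proof. by rewrite cabsE ComplexField.Normc.normc1. Qed.

Lemma cabs_eq0 z : (cabs z == 0) = (z == 0).
Proof.
apply/eqP/eqP => [|->]; last exact: cabs0.
by rewrite cabsE => /ComplexField.Normc.eq0_normc.
Qed.

Lemma cabs_gt0 z : (0 < cabs z) = (z != 0).
Proof. by rewrite lt_def cabs_eq0 cabs_ge0 andbT. Qed.

Lemma cabsM z w : cabs (z * w) = cabs z * cabs w.
Proof. by rewrite !cabsE ComplexField.Normc.normcM. Qed.

Lemma cabsV z : cabs z^-1 = (cabs z)^-1.
Proof. by rewrite !cabsE ComplexField.Normc.normcV. Qed.

Lemma cabsX z n : cabs (z ^+ n) = cabs z ^+ n.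
Proof. by elim: n => [|n IH]; rewrite ?expr0 ?cabs1 // !exprS cabsM IH. Qed.

Lemma cabsD z w : cabs (z + w) <= cabs z + cabs w.
Proof. by rewrite !cabsE le_normcD. Qed.

Lemma cabsN z : cabs (- z) = cabs z.
Proof. by rewrite !cabsE normcN. Qed.

Lemma cabsB z w : cabs z - cabs w <= cabs (z - w).
Proof. by rewrite lerBlDr -{1}(subrK w z) cabsD. Qed.

Lemma cabsB_leD z w : cabs z - cabs w <= cabs (z + w).
Proof. by rewrite -(cabsN w) -{2}(opprK w) cabsB. Qed.

Lemma cabs_distC z w : cabs (z - w) = cabs (w - z).
Proof. by rewrite -cabsN opprB. Qed.

Lemma cabsBD z w : cabs (z - w) <= cabs z + cabs w.
Proof. by rewrite (le_trans (cabsD _ _)) // cabsN. Qed.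

Lemma cabs_dist_dist z w : `|cabs z - cabs w| <= cabs (z - w).
Proof. by rewrite ler_norml cabsB andbT lerNl opprB cabs_distC cabsB. Qed.

Lemma cabs_real r : cabs (r%:C)%C = `|r|.
Proof. by rewrite /cabs /= expr0n addr0 sqrtr_sqr. Qed.

Lemma cabs_expi t : cabs (expi t : R[i]) = 1.
Proof. by rewrite /cabs /= cos2Dsin2 sqrtr1. Qed.

Variable n : nat.
Implicit Types (x y : 'rV[R[i]]_n).

Lemma vnorm_ge0 x : 0 <= vnorm x. Proof. exact: sqrtr_ge0. Qed.

Lemma vnorm_sqr x : vnorm x ^+ 2 = \sum_(j < n) cabs (x ord0 j) ^+ 2.
Proof. by rewrite sqr_sqrtr // sumr_ge0 // => j _; rewrite sqr_ge0. Qed.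

Lemma vnorm0 : vnorm (0 : 'rV[R[i]]_n) = 0.
Proof.
by rewrite /vnorm big1 ?sqrtr0 // => j _; rewrite mxE cabs0 expr0n.
Qed.

Lemma vnormZ (a : R[i]) x : vnorm (a *: x) = cabs a * vnorm x.
Proof.
apply/eqP; rewrite -(@eqrXn2 _ 2) ?mulr_ge0 ?vnorm_ge0 ?cabs_ge0 //.
rewrite exprMn !vnorm_sqr mulr_sumr; apply/eqP/eq_bigr => j _.
by rewrite mxE cabsM exprMn.
Qed.

Lemma vnormN x : vnorm (- x) = vnorm x.
Proof. by rewrite -scaleN1r vnormZ cabsN cabs1 mul1r. Qed.

Lemma vnorm_eq0 x : vnorm x = 0 -> x = 0.
Proof.
move=> x0; apply/rowP => j; rewrite mxE; apply/eqP; rewrite -cabs_eq0.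
have := vnorm_sqr x; rewrite x0 expr0n => /esym/eqP.
rewrite psumr_eq0 => [/allP/(_ j)|i _]; last exact: sqr_ge0.
by rewrite mem_index_enum => /(_ isT) /=; rewrite sqrf_eq0.
Qed.

Lemma cabs_le_vnorm x j : cabs (x ord0 j) <= vnorm x.
Proof.
rewrite -(@ler_pXn2r _ 2) ?nnegrE ?cabs_ge0 ?vnorm_ge0 //.
rewrite vnorm_sqr (bigD1 j) //= lerDl sumr_ge0 // => i _; exact: sqr_ge0.
Qed.

Lemma cauchy_schwarz_sum (a b : 'I_n -> R) :
  (\sum_j a j * b j) ^+ 2 <= (\sum_j a j ^+ 2) * (\sum_j b j ^+ 2).
Proof.
set S := \sum_j a j * b j; set A := \sum_j a j ^+ 2; set B := \sum_j b j ^+ 2.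
have A0 : 0 <= A by apply: sumr_ge0 => j _; exact: sqr_ge0.
have key t : 0 <= t ^+ 2 * A - t * S *+ 2 + B.
  have -> : t ^+ 2 * A - t * S *+ 2 + B = \sum_j (t * a j - b j) ^+ 2.
    rewrite /A /S /B !mulr_sumr -sumrMnl -sumrB -big_split /=.
    by apply: eq_bigr => j _; ring.
  by apply: sumr_ge0 => j _; exact: sqr_ge0.
have [A1|A1] := eqVneq A 0.
  have -> : S = 0.
    rewrite /S big1 // => j _; apply/eqP; rewrite mulf_eq0; apply/orP; left.
    move/eqP: A1; rewrite psumr_eq0 => [/allP/(_ j)|i _]; last exact: sqr_ge0.
    by rewrite mem_index_enum => /(_ isT) /=; rewrite sqrf_eq0.
  by rewrite A1 mul0r expr0n.
have Agt0 : 0 < A by rewrite lt_def A1.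
(* [S / A] minimises the quadratic in [key]; its minimum, multiplied by [A], is [A * B - S ^+ 2]. *)
have := key (S / A).
rewrite -(@pmulr_rge0 _ A) //.
have -> : A * ((S / A) ^+ 2 * A - S / A * S *+ 2 + B) = A * B - S ^+ 2.
  by field.
by rewrite subr_ge0.
Qed.

Lemma vnormD x y : vnorm (x + y) <= vnorm x + vnorm y.
Proof.
rewrite -(@ler_pXn2r _ 2) ?nnegrE ?addr_ge0 ?vnorm_ge0 //.
rewrite sqrrD !vnorm_sqr.
apply: (@le_trans _ _ (\sum_j (cabs (x ord0 j) + cabs (y ord0 j)) ^+ 2)).
  apply: ler_sum => j _; rewrite lerXn2r ?nnegrE ?addr_ge0 ?cabs_ge0 //.
  by rewrite mxE cabsD.
under eq_bigr do rewrite sqrrD.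
rewrite big_split /= big_split /= lerD2r lerD2l sumrMnl lerMn2r /=.
rewrite -(@ler_pXn2r _ 2) ?nnegrE ?mulr_ge0 ?vnorm_ge0 ?sumr_ge0 //; last first.
  by move=> j _; rewrite mulr_ge0 ?cabs_ge0.
by rewrite exprMn !vnorm_sqr cauchy_schwarz_sum.
Qed.

Lemma vnormBD x y : vnorm (x - y) <= vnorm x + vnorm y.
Proof. by rewrite (le_trans (vnormD _ _)) // vnormN. Qed.

Lemma vnorm_sum (I : finType) (F : I -> 'rV[R[i]]_n) :
  vnorm (\sum_i F i) <= \sum_i vnorm (F i).
Proof.
elim/big_rec2: _ => [|i a y _ IH]; first by rewrite vnorm0.
by rewrite (le_trans (vnormD _ _)) // lerD2l.
Qed.

Lemma vnorm_delta (j : 'I_n) : vnorm (delta_mx ord0 j : 'rV[R[i]]_n) = 1.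
Proof.
rewrite /vnorm (bigD1 j) //= mxE !eqxx /= cabs1 expr1n big1 ?addr0 ?sqrtr1 //.
by move=> i ij; rewrite mxE (negPf ij) andbF cabs0 expr0n.
Qed.

End Norms.

Lemma mulmx_bound (R : realType) n m (L : 'M[R[i]]_(n, m)) :
  exists2 c : R, 0 < c & forall x, vnorm (x *m L) <= c * vnorm x.
Proof.
(* The summand 1 keeps the constant positive when [L = 0]. *)
exists (1 + \sum_j vnorm (row j L)).
  by rewrite ltr_wpDr // sumr_ge0 // => j _; exact: vnorm_ge0.
move=> x; rewrite mulmx_sum_row (le_trans (vnorm_sum _)) //.
rewrite mulrDl mul1r mulr_suml ler_wpDl ?vnorm_ge0 //.
apply: ler_sum => j _; rewrite vnormZ mulrC ler_wpM2l ?vnorm_ge0 //.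
exact: cabs_le_vnorm.
Qed.

Section Derivatives.
Variable R : realType.

Lemma hasCderiv_affine n m (A : 'M[R[i]]_(n, m)) b z :
  hasCderiv (fun w => w *m A + b) z A.
Proof.
move=> e e0; exists 1 => // h _.
rewrite mulmxDl (_ : _ - _ = 0) ?vnorm0 ?mulr_ge0 ?vnorm_ge0 ?ltW //.
by move: (z *m A) (h *m A) => x y; apply/rowP => j; rewrite !mxE; ring.
Qed.

Lemma eq_hasCderiv n m (f g : 'rV[R[i]]_n -> 'rV[R[i]]_m) z L :
  f =1 g -> hasCderiv f z L -> hasCderiv g z L.
Proof. by move=> /funext ->. Qed.

Lemma hasCderiv_id n (z : 'rV[R[i]]_n) : hasCderiv id z 1%:M.
Proof.
apply: eq_hasCderiv (hasCderiv_affine 1%:M 0 z) => w.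
by rewrite mulmx1 addr0.
Qed.

Lemma hasCderiv_bound n m (f : 'rV[R[i]]_n -> 'rV[R[i]]_m) z L :
  hasCderiv f z L -> exists2 c : R, 0 < c & exists2 d : R, 0 < d &
    forall h, vnorm h < d -> vnorm (f (z + h) - f z) <= c * vnorm h.
Proof.
move=> /(_ 1 ltr01) [d d0 hd]; have [c c0 hc] := mulmx_bound L.
exists (1 + c); first by rewrite addr_gt0.
exists d => // h hh; rewrite -(subrK (h *m L) (f _ - f _)).
by rewrite (le_trans (vnormD _ _)) // mulrDl lerD ?hd.
Qed.

Lemma hasCderiv_cont n m (f : 'rV[R[i]]_n -> 'rV[R[i]]_m) z L :
  hasCderiv f z L -> forall e : R, 0 < e -> exists2 d : R, 0 < d &
    forall w, vnorm (w - z) < d -> vnorm (f w - f z) < e.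
Proof.
move=> /hasCderiv_bound[c c0 [d d0 hc]] e e0.
exists (Num.min d (e / c)); first by rewrite lt_min d0 divr_gt0.
move=> w; rewrite lt_min => /andP[w1 w2].
rewrite -{1}(subrK z w) [w - z + z]addrC (le_lt_trans (hc _ w1)) //.
by rewrite mulrC -ltr_pdivlMr.
Qed.

Lemma hasCderiv_comp n m p (f : 'rV[R[i]]_n -> 'rV[R[i]]_m)
    (g : 'rV[R[i]]_m -> 'rV[R[i]]_p) z L M :
  hasCderiv f z L -> hasCderiv g (f z) M -> hasCderiv (g \o f) z (L *m M).
Proof.
move=> df dg e e0.
have [c c0 [d1 d10 hc]] := hasCderiv_bound df.
have [k k0 hk] := mulmx_bound M.
have [|d2 d20 h2] := dg (e / 2 / c); first by rewrite !divr_gt0.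
have [|d3 d30 h3] := df (e / 2 / k); first by rewrite !divr_gt0.
exists (Num.min d1 (Num.min (d2 / c) d3)).
  by rewrite !lt_min d10 d30 divr_gt0.
move=> h; rewrite !lt_min => /and3P[h1]; rewrite ltr_pdivlMr // => hh2 hh3 /=.
have {}hc := hc _ h1.
have := h2 (f (z + h) - f z); rewrite [f z + _]addrC subrK => {}h2.
have {}h2 : vnorm (g (f (z + h)) - g (f z) - (f (z + h) - f z) *m M)
    <= e / 2 * vnorm h.
  apply: le_trans (h2 _) _; first by rewrite (le_lt_trans hc) // mulrC.
  apply: (@le_trans _ _ (e / 2 / c * (c * vnorm h))).
    by rewrite ler_wpM2l // !divr_ge0 // ltW.
  by rewrite mulrA divfK // gt_eqF.
have {}h3 : vnorm ((f (z + h) - f z - h *m L) *m M) <= e / 2 * vnorm h.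
  rewrite (le_trans (hk _)) // -ler_pdivlMl //.
  by rewrite mulrA [k^-1 * _]mulrC h3.
(* The remainder of the composite is the remainder of [g] at the increment of [f], plus [M] applied
   to the remainder of [f]; each receives half of [e]. *)
rewrite (_ : _ - _ = (g (f (z + h)) - g (f z) - (f (z + h) - f z) *m M) +
   (f (z + h) - f z - h *m L) *m M); last first.
  by rewrite (mulmxBl (f (z + h) - f z) (h *m L)) mulmxA addrA subrK.
by rewrite (le_trans (vnormD _ _)) // [e]splitr mulrDl lerD.
Qed.

(** The bound by [e * vnorm h] holds for small [h], hence for every [h] by homogeneity of [L - M];
    letting [e] tend to 0 kills each row. *)
Lemma hasCderiv_uniq n m (f : 'rV[R[i]]_n -> 'rV[R[i]]_m) z L M :
  hasCderiv f z L -> hasCderiv f z M -> L = M.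
Proof.
move=> dL dM.
have small e (h : 'rV[R[i]]_n) : 0 < e -> vnorm (h *m (L - M)) <= e * vnorm h.
  move=> e0; have e20 : 0 < e / 2 by rewrite divr_gt0.
  have [d1 d10 h1] := dL _ e20; have [d2 d20 h2] := dM _ e20.
  have [h0|hn0] := eqVneq (vnorm h) 0.
    by rewrite (vnorm_eq0 h0) mul0mx !vnorm0 mulr0.
  have hgt : 0 < vnorm h by rewrite lt_def hn0 vnorm_ge0.
  pose t := Num.min d1 d2 / 2 / vnorm h.
  have t0 : 0 < t by rewrite !divr_gt0 // lt_min d10.
  pose g := (t%:C)%C *: h.
  have ng : vnorm g = Num.min d1 d2 / 2.
    by rewrite vnormZ cabs_real gtr0_norm // divfK.
  have lt2 : Num.min d1 d2 / 2 < Num.min d1 d2.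
    by rewrite ltr_pdivrMr // ltr_pMr ?lt_min ?d10 // ltr1n.
  have {}h1 : vnorm (f (z + g) - f z - g *m L) <= e / 2 * vnorm g.
    by apply: h1; rewrite ng (lt_le_trans lt2) // ge_min lexx.
  have {}h2 : vnorm (f (z + g) - f z - g *m M) <= e / 2 * vnorm g.
    by apply: h2; rewrite ng (lt_le_trans lt2) // ge_min lexx orbT.
  have : vnorm (g *m (L - M)) <= e * vnorm g.
    rewrite (_ : g *m _ = (f (z + g) - f z - g *m M) -
        (f (z + g) - f z - g *m L)); last first.
      rewrite mulmxBr; move: (f _ - f _) (g *m L) (g *m M) => a b c.
      by apply/rowP => j; rewrite !mxE; ring.
    by rewrite (le_trans (vnormBD _ _)) // [e]splitr mulrDl lerD.
  rewrite -scalemxAl !vnormZ cabs_real gtr0_norm // mulrCA ler_pM2l //.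
apply/eqP; rewrite -subr_eq0; apply/eqP/row_matrixP => j.
rewrite rowE row0; apply/vnorm_eq0/eqP; rewrite eq_le vnorm_ge0 andbT.
by apply/ler_addgt0Pl => e e0; rewrite addr0 -[e]mulr1 -(vnorm_delta R j) small.
Qed.

Lemma holomorphic_comp n m p (U : set 'rV[R[i]]_n) (V : set 'rV[R[i]]_m)
    (f : 'rV[R[i]]_n -> 'rV[R[i]]_m) (g : 'rV[R[i]]_m -> 'rV[R[i]]_p) :
  holomorphic U f -> holomorphic V g -> (forall z, U z -> V (f z)) ->
  holomorphic U (g \o f).
Proof.
move=> hf hg UV z Uz; have [L dL] := hf _ Uz; have [M dM] := hg _ (UV _ Uz).
by exists (L *m M); exact: hasCderiv_comp.
Qed.

Lemma holomorphic_affine n m (U : set 'rV[R[i]]_n) (A : 'M[R[i]]_(n, m)) b :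
  holomorphic U (fun w => w *m A + b).
Proof. by move=> z _; exists A; exact: hasCderiv_affine. Qed.

Lemma copen_preim n m (f : 'rV[R[i]]_n -> 'rV[R[i]]_m) V :
  holomorphic setT f -> copen V -> copen (f @^-1` V).
Proof.
move=> hf oV z Vfz; have [r r0 hr] := oV _ Vfz; have [L dL] := hf z I.
by have [d d0 hd] := hasCderiv_cont dL r0; exists d => // w /hd /hr.
Qed.

Lemma copen_ball n (c : 'rV[R[i]]_n) (r : R) : copen [set z | vnorm (z - c) < r].
Proof.
move=> z /= zr; exists (r - vnorm (z - c)); first by rewrite subr_gt0.
move=> w; rewrite ltrBrDr /=; apply: le_lt_trans.
by rewrite (_ : w - c = (w - z) + (z - c)) ?vnormD // addrA subrK.
Qed.

End Derivatives.

(** * Polynomial estimates and polynomial shears *)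

Section Polynomials.
Variable R : realType.

(** Horner induction: for P X + c the terms of order h^2 collect into P'(x) + T(h) (x + h). Doubling
    [T.[0]] avoids a division by 2. *)
Lemma poly_taylor2 (F : comNzRingType) (P : {poly F}) x :
  exists T : {poly F},
    (forall h, P.[x + h] = P.[x] + P^`().[x] * h + h ^+ 2 * T.[h]) /\
    T.[0] *+ 2 = P^`(2).[x].
Proof.
rewrite -[P^`(2)]/(P^`()^`()).
elim/poly_ind: P => [|P c [T [hT T0]]].
  by exists 0; split=> [h|]; rewrite ?linear0 !horner0 ?linear0 ?mul0rn //; ring.
exists (P^`().[x]%:P + T * (x%:P + 'X)); split => [h|].
  by rewrite derivD derivM derivX derivC !hornerE hT; ring.
rewrite derivD derivM derivX derivC addr0 mulr1 derivD derivM derivX mulr1.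
by rewrite !hornerE -T0; ring.
Qed.

Lemma poly_bounded (P : {poly R[i]}) :
  exists2 K : R, 0 < K & forall x, cabs x <= 1 -> cabs P.[x] <= K.
Proof.
elim/poly_ind: P => [|P c [K K0 hK]].
  by exists 1 => // x _; rewrite horner0 cabs0.
exists (K + cabs c) => [|x x1]; first by rewrite ltr_wpDr ?cabs_ge0.
rewrite !hornerE (le_trans (cabsD _ _)) // lerD2r cabsM.
by rewrite (le_trans _ (hK _ x1)) // ler_piMr ?cabs_ge0.
Qed.

Lemma poly_lipschitz (P : {poly R[i]}) :
  exists2 K : R, 0 < K & forall x y, cabs x <= 1 -> cabs y <= 1 ->
    cabs (P.[x] - P.[y]) <= K * cabs (x - y).
Proof.
elim/poly_ind: P => [|P c [K K0 hK]].
  by exists 1 => // x y _ _; rewrite !horner0 subrr cabs0 mul1r cabs_ge0.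
have [B B0 hB] := poly_bounded P.
exists (K + B) => [|x y x1 y1]; first by rewrite addr_gt0.
rewrite !hornerE.
rewrite (_ : _ - _ = (P.[x] - P.[y]) * x + P.[y] * (x - y)); last by ring.
rewrite (le_trans (cabsD _ _)) // !cabsM mulrDl lerD //.
  by rewrite (le_trans _ (hK _ _ x1 y1)) // ler_piMr ?cabs_ge0.
by rewrite ler_wpM2r ?cabs_ge0 // hB.
Qed.

(** Both [step] and its inverse [istep] have this form, so holomorphy is proved once for the two of
    them. *)
Definition shear n (A : 'M[R[i]]_n) i (P : {poly R[i]}) (v z : 'rV_n) :=
  z *m A + P.[z ord0 i] *: v.

Definition dshear n (A : 'M[R[i]]_n) i (P : {poly R[i]}) (v z : 'rV_n) :=
  A + P^`().[z ord0 i] *: (delta_mx i ord0 *m v).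

Lemma mul_dshear n (A : 'M[R[i]]_n) i P v z (h : 'rV_n) :
  h *m dshear A i P v z = h *m A + (P^`().[z ord0 i] * h ord0 i) *: v.
Proof.
rewrite mulmxDr -scalemxAr mulmxA; congr (_ + _).
rewrite -scalerA; congr (_ *: _).
rewrite -[_ *m delta_mx i ord0]colE.
by apply/rowP => j; rewrite !mxE big_ord1 !mxE.
Qed.

Lemma hasCderiv_shear n (A : 'M[R[i]]_n) i P v z :
  hasCderiv (shear A i P v) z (dshear A i P v z).
Proof.
move=> e e0; have [T [hT _]] := poly_taylor2 P (z ord0 i).
have [K K0 hK] := poly_bounded T.
have v0 : 0 < vnorm v + 1 by rewrite ltr_wpDl ?vnorm_ge0.
(* The remainder is h_i^2 T(h_i) v, of norm at most |h|^2 K |v|, with |h| < 1 needed for the bound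
   [K]. The 1 added to [vnorm v] covers [v = 0]. *)
exists (Num.min 1 (e / (K * (vnorm v + 1)))).
  by rewrite lt_min ltr01 divr_gt0 // mulr_gt0.
move=> h; rewrite lt_min => /andP[h1].
rewrite ltr_pdivlMr ?mulr_gt0 // => h2.
rewrite mul_dshear /shear mulmxDl mxE hT.
rewrite (_ : _ - _ = (h ord0 i ^+ 2 * T.[h ord0 i]) *: v); last first.
  by apply/rowP => j; rewrite !mxE; ring.
have hi := cabs_le_vnorm h i.
rewrite vnormZ cabsM cabsX.
apply: (@le_trans _ _ (vnorm h ^+ 2 * K * vnorm v)).
  rewrite ler_wpM2r ?vnorm_ge0 // ler_pM ?sqr_ge0 ?cabs_ge0 //.
    by rewrite ler_pXn2r ?nnegrE ?cabs_ge0 ?vnorm_ge0.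
  by rewrite hK // (le_trans hi) // ltW.
rewrite [X in _ <= X]mulrC expr2 -!mulrA ler_wpM2l ?vnorm_ge0 //.
apply: le_trans (ltW h2); rewrite ler_wpM2l ?vnorm_ge0 //.
by rewrite ler_wpM2l ?lerDl // ltW.
Qed.

Lemma holomorphic_shear n (A : 'M[R[i]]_n) i P v U :
  holomorphic U (shear A i P v).
Proof. by move=> z _; exists (dshear A i P v z); exact: hasCderiv_shear. Qed.

End Polynomials.

(** * Jensen inequality for polynomials *)

Section Jensen.
Variable R : realType.
Implicit Types (f g F : R -> R) (t x : R) (P : {poly R[i]}).

Local Notation mu := (@lebesgue_measure R).

Lemma continuous_eps f :
  (forall t e, 0 < e -> exists2 d : R, 0 < d &
     forall s, `|s - t| < d -> `|f s - f t| < e) -> continuous f.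
Proof.
move=> hf t; apply/cvgrPdist_lt => e e0; have [d d0 hd] := hf t e e0.
near=> s; rewrite distrC; apply: hd; near: s.
exact: cvgr_distC_lt.
Unshelve. all: by end_near. Qed.

Lemma eps_continuous f : continuous f -> forall t e, 0 < e ->
  exists2 d : R, 0 < d & forall s, `|s - t| < d -> `|f s - f t| < e.
Proof.
move=> cf t e e0; have /cvgrPdist_lt/(_ e e0)/nbhs_ballP[d d0 hd] := cf t.
exists d => // s st; rewrite distrC; apply: hd.
by rewrite -ball_normE /= distrC.
Qed.

Lemma continuous_integrable f a b :
  continuous f -> mu.-integrable `[a, b] (EFin \o f).
Proof.
move=> cf; apply: continuous_compact_integrable; first exact: segment_compact.
exact: continuous_subspaceT.
Qed.

(** Integrating from -1 instead of 0 gives a two-sided derivative at 0 as well, the left end of the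
    circle parameter. *)
Lemma ex_primitive f : continuous f ->
  exists F, forall x, -1 < x -> is_derive x 1 F (f x).
Proof.
move=> cf; exists (fun x => \int[mu]_(t in `[-1, x]) f t)%R => x x1.
have [dF F'] : derivable (fun x => \int[mu]_(t in `[-1, x]) f t)%R x 1 /\
    derive1 (fun x => \int[mu]_(t in `[-1, x]) f t)%R x = f x.
  apply: (@continuous_FTC1_closed _ f (-1) x (x + 1)) => //.
  - by rewrite ltrDl.
  - exact: continuous_integrable.
  - exact: cf.
apply: DeriveDef; first exact: dF.
by rewrite -derive1E F'.
Qed.

Lemma Rintegral_primitive f F c a b : continuous f -> c < a -> a < b ->
  (forall x, c < x -> is_derive x 1 F (f x)) ->
  (\int[mu]_(t in `[a, b]) f t)%R = F b - F a.
Proof.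
move=> cf ca ab dF.
have cF x : c < x -> {for x, continuous F}.
  by move=> /dF dx; apply: differentiable_continuous; apply/derivable1_diffP.
rewrite /Rintegral (@continuous_FTC2 _ f F) //.
- exact: continuous_subspaceT.
- split.
  + by move=> x /itvP xab; have [] := dF x (lt_trans ca _); rewrite ?xab.
  + by apply: cvg_at_right_filter; exact: cF.
  + by apply: cvg_at_left_filter; apply: cF; exact: lt_trans ab.
- move=> x /itvP xab; have := dF x; case=> [|_].
    by rewrite (lt_trans ca) ?xab.
  by rewrite derive1E.
Qed.

(* Primitives of f and g give two primitives of t |-> g (2 t) on [0, pi]; no
   change of variables is needed. *)
Lemma Rintegral_doubling f g : continuous f -> continuous g ->
  (forall t, f t + f (t + pi) = g (2 * t)) ->
  (\int[mu]_(t in `[0, 2 * pi]) g t = 2 * \int[mu]_(t in `[0, 2 * pi]) f t)%R.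
Proof.
move=> cf cg fg; have pi0 := pi_gt0 R.
have [F dF] := ex_primitive cf; have [G dG] := ex_primitive cg.
have pi20 : 0 < 2 * pi :> R by rewrite mulr_gt0.
rewrite (Rintegral_primitive cf _ pi20 dF) ?ltrN10 //.
rewrite (Rintegral_primitive cg _ pi20 dG) ?ltrN10 //.
have cg2 : continuous (fun t => g (2 * t) * 2).
  move=> t; apply: (@cvgM _ _ (nbhs t)); last exact: cvg_cst.
  apply: (@continuous_comp _ _ _ (fun t => 2 * t) g); last exact: cg.
  exact: mulrl_continuous.
have dFpi x : -1 < x -> is_derive x 1 (F \o (fun t => t + pi)) (f (x + pi)).
  move=> x1; rewrite -[f _]mulr1; apply: is_derive1_comp.
    by apply: dF; rewrite ltr_wpDr // ltW.
  by have := is_deriveD (is_derive_id x 1) (is_derive_cst pi x 1); rewrite addr0.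
have dFF x : -1 < x ->
    is_derive x 1 (F + (F \o (fun t => t + pi))) (g (2 * x)).
  by move=> x1; rewrite -fg; apply: is_deriveD; [exact: dF|exact: dFpi].
have dA x : -1 < x -> is_derive x 1 ((F + (F \o (fun t => t + pi))) +
    (F + (F \o (fun t => t + pi)))) (g (2 * x) * 2).
  by move=> x1; rewrite mulr_natr mulr2n; apply: is_deriveD; exact: dFF.
have dB x : - 2^-1 < x -> is_derive x 1 (G \o (fun t => 2 * t)) (g (2 * x) * 2).
  move=> x1; apply: is_derive1_comp; first by apply: dG; lra.
  have := is_deriveZ 2 (is_derive_id x 1).
  by rewrite (_ : 2 *: 1 = 2) // /GRing.scale /= mulr1.
(* Both primitives of 2 g(2t) are evaluated between 0 and pi. The two values of F at pi cancel,
   which leaves 2 (F(2 pi) - F(0)) = G(2 pi) - G(0). *)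
have := Rintegral_primitive cg2 _ (pi_gt0 R) dA; rewrite ltrN10 => /(_ isT).
rewrite (Rintegral_primitive cg2 _ (pi_gt0 R) dB) ?oppr_lt0 ?invr_gt0 //.
rewrite !fctE /= mulr0 add0r mulr_natl mulr2n => ->; ring.
Qed.

Lemma expiD s t : expi (s + t) = expi s * expi t :> R[i].
Proof.
apply/eqP; rewrite eq_complex /= cosD sinD; apply/andP; split; apply/eqP => //.
by rewrite addrC [cos s * _]mulrC; ring.
Qed.

Lemma expi_pi : expi pi = -1 :> R[i].
Proof. by apply/eqP; rewrite eq_complex /= cospi sinpi oppr0 !eqxx. Qed.

Lemma expi_continuous t (e : R) : 0 < e -> exists2 d : R, 0 < d &
  forall s, `|s - t| < d -> cabs (expi s - expi t : R[i]) < e.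
Proof.
move=> e0; have e20 : 0 < e / 2 by rewrite divr_gt0.
have [d1 d10 h1] := eps_continuous (@continuous_cos R) t e20.
have [d2 d20 h2] := eps_continuous (@continuous_sin R) t e20.
exists (Num.min d1 d2); first by rewrite lt_min d10.
move=> s; rewrite lt_min => /andP[/h1 {}h1 /h2 {}h2].
rewrite (_ : _ - _ = ((cos s - cos t)%:C + 'i * (sin s - sin t)%:C)%C); last first.
  by apply/eqP; rewrite eq_complex /=; apply/andP; split; apply/eqP; ring.
rewrite (le_lt_trans (cabsD _ _)) // cabsM !cabs_real.
rewrite (_ : cabs 'i%C = 1) ?mul1r; last first.
  by rewrite /cabs /= expr0n expr1n add0r sqrtr1.
by rewrite [e]splitr ltrD.
Qed.

Lemma cabs_poly_continuous P : continuous (fun t => cabs P.[expi t]).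
Proof.
apply: continuous_eps => t e e0; have [K K0 hK] := poly_lipschitz P.
have [|d d0 hd] := @expi_continuous t (e / K); first by rewrite divr_gt0.
exists d => // s /hd; rewrite ltr_pdivlMr // mulrC => h.
rewrite (le_lt_trans (cabs_dist_dist _ _)) // (le_lt_trans _ h) //.
by rewrite hK ?cabs_expi.
Qed.

Lemma ln_continuous_comp f : continuous f -> (forall t, 0 < f t) ->
  continuous (fun t => ln (f t)).
Proof.
move=> cf f0 t; apply: continuous_cvg; last exact: cf.
exact: continuous_ln.
Qed.

Lemma max_lipschitz (x y d : R) : `|Num.max x d - Num.max y d| <= `|x - y|.
Proof.
rewrite ler_norml; move: (ler_norm (x - y)) (lerNnormlW (lexx `|x - y|)).
move: `|_| => N; rewrite /Num.max => h1 h2.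
by case: ifP; case: ifP => //; lra.
Qed.

Lemma max_continuous f (d : R) : continuous f ->
  continuous (fun t => Num.max (f t) d).
Proof.
move=> cf; apply: continuous_eps => t e e0.
have [r r0 hr] := eps_continuous cf t e0.
by exists r => // s /hr; apply: le_lt_trans; exact: max_lipschitz.
Qed.

Lemma log_max_continuous P (d : R) : 0 < d ->
  continuous (fun t => ln (Num.max (cabs P.[expi t]) d)).
Proof.
move=> d0; apply: ln_continuous_comp => [|t]; last by rewrite lt_max d0 orbT.
exact/max_continuous/cabs_poly_continuous.
Qed.

Lemma Rintegral_circle_cst (c : R) :
  (\int[mu]_(t in `[0, 2 * pi]) c = c * (2 * pi))%R.
Proof.
have pi20 : 0 < 2 * pi :> R by rewrite mulr_gt0 ?pi_gt0.
rewrite Rintegral_cst //; congr (_ * _).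
transitivity (fine (lebesgue_measure (`[0%R, 2 * pi]%classic : set R))) => //.
by rewrite lebesgue_measure_itv /= lte_fin pi20 sube0.
Qed.

Lemma le_Rintegral_circle f g : continuous f -> continuous g ->
  (forall t, 0 <= t <= 2 * pi -> f t <= g t) ->
  (\int[mu]_(t in `[0, 2 * pi]) f t <= \int[mu]_(t in `[0, 2 * pi]) g t)%R.
Proof.
by move=> cf cg fg; apply: le_Rintegral => //; exact: continuous_integrable.
Qed.

Lemma Rintegral_circleD f g : continuous f -> continuous g ->
  (\int[mu]_(t in `[0, 2 * pi]) (f t + g t) =
   \int[mu]_(t in `[0, 2 * pi]) f t + \int[mu]_(t in `[0, 2 * pi]) g t)%R.
Proof. by move=> cf cg; apply: RintegralD => //; exact: continuous_integrable. Qed.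

Lemma exp2_bounded_le0 x c : (forall n, 2 ^+ n * x <= c) -> x <= 0.
Proof.
move=> h; rewrite leNgt; apply/negP => x0.
have := h (Num.bound `|c / x|); apply/negP; rewrite -ltNge -ltr_pdivrMr //.
apply: le_lt_trans (ler_norm _) _; apply: lt_le_trans (archi_boundP _) _ => //.
by rewrite -natrX ler_nat; exact/ltnW/ltn_expl.
Qed.

(** * Circle averages of log |e^(it) - a| *)

Definition log_circle (a : R[i]) t : R := ln (cabs (expi t - a)).

Lemma cabs_expiB_gt0 (a : R[i]) t : cabs a != 1 -> 0 < cabs (expi t - a).
Proof.
rewrite cabs_gt0 subr_eq0; apply: contraNneq => <-.
by rewrite cabs_expi.
Qed.

Lemma log_circle_continuous a : cabs a != 1 -> continuous (log_circle a).
Proof.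
move=> a1; apply: ln_continuous_comp => [|t]; last exact: cabs_expiB_gt0.
have -> : (fun t => cabs (expi t - a)) = fun t => cabs ('X - a%:P).[expi t].
  by apply/funext => t; rewrite !hornerE.
exact: cabs_poly_continuous.
Qed.

(** Antipodal points multiply: (e^(it) - a)(e^(i(t + pi)) - a) = -(e^(2it) - a^2). Taking log of the
    modulus puts this in the form of [Rintegral_doubling]. *)
Lemma log_circle_double a : cabs a != 1 ->
  (\int[mu]_(t in `[0, 2 * pi]) log_circle (a ^+ 2) t =
   2 * \int[mu]_(t in `[0, 2 * pi]) log_circle a t)%R.
Proof.
move=> a1; have a21 : cabs (a ^+ 2) != 1.
  by rewrite cabsX sqrp_eq1 ?cabs_ge0.
apply: Rintegral_doubling; try exact: log_circle_continuous.
move=> t; rewrite /log_circle -lnM ?posrE ?cabs_expiB_gt0 // -cabsM.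
rewrite [2 * t]mulr_natl mulr2n (expiD t t) (expiD t pi) expi_pi.
by rewrite -cabsN; congr (ln (cabs _)); ring.
Qed.

Lemma log_circle_pow a n : cabs a != 1 ->
  (\int[mu]_(t in `[0, 2 * pi]) log_circle (a ^+ (2 ^ n)) t =
   2 ^+ n * \int[mu]_(t in `[0, 2 * pi]) log_circle a t)%R.
Proof.
move=> a1; elim: n => [|n IH]; first by rewrite expn0 expr1 mul1r.
rewrite expnSr exprM log_circle_double ?IH ?exprS ?mulrA //.
by rewrite cabsX pexpr_eq1 ?expn_gt0 ?cabs_ge0.
Qed.

Lemma log_circle_ge a : a != 0 -> cabs a != 1 ->
  ln (cabs a) * (2 * pi) <= \int[mu]_(t in `[0, 2 * pi]) log_circle a t.
Proof.
move=> a0 a1; have pi20 : 0 < 2 * pi :> R by rewrite mulr_gt0 ?pi_gt0.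
have r0 : 0 < cabs a by rewrite cabs_gt0.
have lower N : cabs a ^+ N != 1 ->
    ln `|1 - cabs a ^+ N| * (2 * pi) <=
      \int[mu]_(t in `[0, 2 * pi]) log_circle (a ^+ N) t.
  rewrite -cabsX => aN1; rewrite -Rintegral_circle_cst.
  apply: le_Rintegral_circle; [exact: cst_continuous|exact: log_circle_continuous|].
  move=> t _; rewrite ler_ln ?posrE ?normr_gt0 ?cabs_expiB_gt0 //;
    last by rewrite subr_eq0 eq_sym.
  by rewrite -(cabs_expi t) cabs_dist_dist.
(* The pointwise lower bound is N log |a| up to a constant independent of N. If |a| < 1, then N log
   |a| <= 0 and 1 - |a|^N >= 1 - |a|; if |a| > 1, factor out |a|^N and use 1 - |a|^-N >= 1 -
   |a|^-1. *)
have [c hc] : exists c : R, forall N, (0 < N)%N ->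
    ln (cabs a) *+ N + c <= ln `|1 - cabs a ^+ N|.
  move: a1; rewrite neq_lt => /orP[a1|a1].
    exists (ln (1 - cabs a)) => -[//|N] _.
    have pw : cabs a ^+ N.+1 <= cabs a.
      by rewrite exprS ler_piMr ?(ltW r0) // exprn_ile1 ?(ltW r0) ?(ltW a1).
    have aN0 : 0 < 1 - cabs a ^+ N.+1 by rewrite subr_gt0 (le_lt_trans pw).
    rewrite gtr0_norm // ler_wnDl //.
      by rewrite mulrn_wle0 // ln_le0 // ltW.
    by rewrite ler_ln ?posrE ?subr_gt0 //; lra.
  exists (ln (1 - (cabs a)^-1)) => -[//|N] _.
  have pw : 1 < cabs a ^+ N.+1 by rewrite exprn_egt1.
  rewrite -lnXn // -lnM ?posrE ?exprn_gt0 // ?subr_gt0 ?invf_lt1 //.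
  rewrite ltr0_norm ?subr_lt0 // opprB.
  rewrite ler_ln ?posrE ?mulr_gt0 ?exprn_gt0 ?subr_gt0 ?invf_lt1 //.
  rewrite mulrBr mulr1 lerD2l lerN2 exprSr mulfK ?gt_eqF //.
  by rewrite exprn_ege1 // ltW.
(* Multiplying the defect by 2^n replaces [a] by its power 2^n, where the error stays below the
   fixed constant; so the defect cannot be positive. *)
rewrite -subr_le0; apply: (@exp2_bounded_le0 _ (- c * (2 * pi))) => n.
rewrite mulrBr -log_circle_pow // lerBlDr -lerBlDl -mulNr opprK.
have N1 : cabs a ^+ (2 ^ n) != 1 by rewrite pexpr_eq1 ?expn_gt0 ?cabs_ge0.
apply: le_trans (lower _ N1).
rewrite (mulrA _ (ln _)) -mulrDl ler_wpM2r ?(ltW pi20) // -natrX mulr_natl.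
by rewrite hc // expn_gt0.
Qed.

(** The logarithm turns the product into a sum, and [log_circle_ge] handles each root. Positivity
    and continuity are carried along the induction because splitting the integral requires them. *)
Lemma jensen_prod (c : R[i]) (rs : seq R[i]) :
  c != 0 -> (forall z, z \in rs -> z != 0 /\ cabs z != 1) ->
  let P := c *: \prod_(z <- rs) ('X - z%:P) in
  [/\ forall t, 0 < cabs P.[expi t],
      continuous (fun t => ln (cabs P.[expi t])) &
      ln (cabs P.[0]) * (2 * pi) <=
        \int[mu]_(t in `[0, 2 * pi]) ln (cabs P.[expi t])].
Proof.
move=> c0; elim: rs => [|z rs IH] hz /=.
  rewrite big_nil alg_polyC; split.
  - by move=> t; rewrite hornerC cabs_gt0.
  - by under eq_fun do rewrite hornerC; exact: cst_continuous.
  - under eq_Rintegral do rewrite hornerC.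
    by rewrite hornerC Rintegral_circle_cst.
have [z0 z1] : z != 0 /\ cabs z != 1 by apply: hz; rewrite mem_head.
have [|Pgt0 cP hP] := IH; first by move=> y yrs; apply: hz; rewrite inE yrs orbT.
set Q := c *: _ in Pgt0 cP hP.
have PE (x : R[i]) : (c *: \prod_(y <- z :: rs) ('X - y%:P)).[x] = (x - z) * Q.[x].
  by rewrite big_cons scalerAr !hornerE.
have lnE t : ln (cabs ((expi t - z) * Q.[expi t])) =
    log_circle z t + ln (cabs Q.[expi t]).
  by rewrite cabsM lnM ?posrE ?cabs_expiB_gt0.
have Q0 : 0 < cabs Q.[0].
  rewrite cabs_gt0 !hornerE mulf_neq0 // horner_prod prodf_seq_neq0.
  apply/allP => y yrs /=; rewrite !hornerE oppr_eq0.
  by have [] := hz y; rewrite ?inE ?yrs ?orbT.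
have cz := log_circle_continuous z1.
split.
- by move=> t; rewrite PE cabsM mulr_gt0 ?cabs_expiB_gt0.
- by under eq_fun do rewrite PE lnE; move=> t; apply: cvgD; [exact: cz|exact: cP].
- under eq_Rintegral do rewrite PE lnE.
  have gz : 0 < cabs z by rewrite cabs_gt0.
  rewrite Rintegral_circleD // PE sub0r cabsM cabsN lnM ?posrE // mulrDl.
  by apply: lerD; [exact: log_circle_ge|exact: hP].
Qed.

(** Whenever an element of [s] falls into the current open interval, the interval is cut off there
    and stays nondegenerate. This supplies the dilation factor of [log_max_submean]. *)
Lemma ex_notin_interval (s : seq R) (a b : R) : a < b ->
  exists2 x, a < x < b & x \notin s.
Proof.
move=> ab; suff [a' [b' [aa ab' bb hs]]] : exists a' b' : R,
    [/\ a <= a', a' < b', b' <= b & forall x, a' < x < b' -> x \notin s].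
  exists ((a' + b') / 2); first by apply/andP; split; lra.
  by apply: hs; apply/andP; split; lra.
elim: s => [|y s [a' [b' [aa ab' bb hs]]]]; first by exists a, b.
have [yI|yI] := boolP (a' < y < b').
  move/andP: yI => [ya yb]; exists a', y; split=> //; first lra.
  move=> x /andP[xa xb]; rewrite inE negb_or lt_eqF //= hs //.
  by rewrite xa (lt_trans xb).
exists a', b'; split=> // x xI; rewrite inE negb_or hs // andbT.
by apply: contraNneq yI => <-.
Qed.

(* The roots on the unit circle are removed by replacing P with P(rho X), rho
   close to 1. *)
Lemma log_max_submean P (d : R) : 0 < d ->
  ln (Num.max (cabs P.[0]) d) * (2 * pi) <=
    \int[mu]_(t in `[0, 2 * pi]) ln (Num.max (cabs P.[expi t]) d).
Proof.
move=> d0; have pi20 : 0 < 2 * pi :> R by rewrite mulr_gt0 ?pi_gt0.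
have mgt0 (x : R[i]) : 0 < Num.max (cabs P.[x]) d by rewrite lt_max d0 orbT.
have cm := @log_max_continuous P d d0.
have [Pd|dP] := leP (cabs P.[0]) d.
  rewrite -Rintegral_circle_cst; apply: le_Rintegral_circle => //.
    exact: cst_continuous.
  by move=> t _; rewrite ler_ln ?posrE // le_max lexx orbT.
have P0 : P.[0] != 0 by rewrite -cabs_gt0 (lt_trans d0).
apply/ler_addgt0Pr => e' e'0; set e := e' / (2 * pi).
have e0 : 0 < e by rewrite divr_gt0.
have [K K0 hK] := poly_lipschitz P.
have Pn0 : P != 0 by apply: contraNneq P0 => ->; rewrite horner0.
have [rP PE] := closed_field_poly_normal P.
(* Avoiding the moduli of the roots of P leaves P(rX) without roots on the unit circle. The lower
   end gives K (1 - r) < e d, so the dilation changes P on the circle by at most e d, which raises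
   the logarithm of the maximum by at most log (1 + e) <= e. *)
have [|r /andP[r1 r2] rN] := @ex_notin_interval (map (@cabs R) rP)
    (Num.max 0 (1 - e * d / K)) 1.
  by rewrite gt_max ltr01 ltrBlDr ltrDl divr_gt0 // mulr_gt0.
move: r1; rewrite gt_max => /andP[r0]; rewrite ltrBlDr -ltrBlDl.
rewrite ltr_pdivlMr // => r1.
pose Q := P \Po ((r%:C)%C *: 'X).
have QE (x : R[i]) : Q.[x] = P.[(r%:C)%C * x] by rewrite horner_comp !hornerE.
have rC0 : (r%:C)%C != 0 :> R[i] by rewrite -cabs_gt0 cabs_real normr_gt0 gt_eqF.
have [rs QrE] := closed_field_poly_normal Q.
have Qn0 : Q != 0.
  apply: contraNneq P0 => Q0; have := QE 0; rewrite Q0 mulr0 => <-.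
  by rewrite horner0.
have Qroot z : z \in rs -> Q.[z] = 0.
  move=> zrs; rewrite QrE hornerZ; apply/eqP; rewrite mulf_eq0; apply/orP; right.
  by rewrite -/(root _ _) root_prod_XsubC.
have [||Qgt0 cQ hQ] := @jensen_prod (lead_coef Q) rs.
- by rewrite lead_coef_eq0.
- move=> z /Qroot; rewrite QE => Pz; split.
    by apply: contraNneq P0 => z0; move: Pz; rewrite z0 mulr0 => ->.
  apply: contraNneq rN => z1; apply/mapP; exists ((r%:C)%C * z).
    move: Pz; rewrite PE hornerZ => /eqP; rewrite mulf_eq0 lead_coef_eq0 (negPf Pn0).
    by rewrite -/(root _ _) root_prod_XsubC.
  by rewrite cabsM z1 mulr1 cabs_real gtr0_norm.
rewrite -{}QrE in Qgt0 cQ hQ; rewrite QE mulr0 in hQ.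
apply: (le_trans hQ).
rewrite -[e'](divfK (lt0r_neq0 pi20)) -/e -Rintegral_circle_cst.
rewrite -Rintegral_circleD //; last exact: cst_continuous.
apply: le_Rintegral_circle => //.
  by move=> t; apply: cvgD; [exact: cm|exact: cvg_cst].
move=> t _; set m := Num.max _ _.
have m0 : 0 < m by exact: mgt0.
apply: (@le_trans _ _ (ln (m * (1 + e)))); last first.
  by rewrite lnM ?posrE ?addr_gt0 // lerD2l le_ln1Dx // (lt_trans _ e0).
rewrite ler_ln ?posrE ?mulr_gt0 ?addr_gt0 // mulrDr mulr1 QE.
have -> : P.[(r%:C)%C * expi t] =
    P.[expi t] + (P.[(r%:C)%C * expi t] - P.[expi t]) by rewrite addrC subrK.
rewrite (le_trans (cabsD _ _)) // lerD //; first by rewrite le_max lexx.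
rewrite (le_trans (hK _ _ _ _)) ?cabs_expi //.
  by rewrite cabsM cabs_expi mulr1 cabs_real gtr0_norm // ltW.
rewrite -[X in _ - X]mul1r -mulrBl cabsM cabs_expi mulr1.
rewrite (_ : _ - 1 = ((r - 1)%:C)%C); last by rewrite rmorphB.
rewrite cabs_real ltr0_norm ?subr_lt0 // opprB mulrC (le_trans (ltW r1)) //.
by rewrite [m * e]mulrC ler_wpM2l ?(ltW e0) // le_max lexx orbT.
Qed.

End Jensen.

(** * Superattracting polynomial *)

Section SuperattractingPolynomial.
Variable R : realType.
Variable m : nat.
Hypothesis m_gt0 : (0 < m)%N.

(** This is x - x (x^m - 1) / m: Newton's map for x^m - 1 with the factor 1 / x^(m-1) replaced by x,
    which equals it at the m-th roots of unity and keeps the map polynomial. *)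
Definition qpoly : {poly R[i]} :=
  (m.+1%:R / m%:R) *: 'X - m%:R^-1 *: 'X^(m.+1).

Let mn0 : m%:R != 0 :> R[i]. Proof. by rewrite pnatr_eq0 -lt0n. Qed.

Lemma horner_qpoly x :
  qpoly.[x] = m.+1%:R / m%:R * x - m%:R^-1 * x ^+ m.+1.
Proof. by rewrite hornerD hornerN !hornerZ hornerX hornerXn. Qed.

Lemma qpoly_fixed p : p ^+ m = 1 -> qpoly.[p] = p.
Proof.
move=> pm; rewrite horner_qpoly exprS pm -[m.+1]addn1 natrD.
by field.
Qed.

(** This symmetry reduces the estimates at every root of unity to those at 1, with common
    constants. *)
Lemma qpoly_equivariant p x : p ^+ m = 1 -> qpoly.[p * x] = p * qpoly.[x].
Proof. by move=> pm; rewrite !horner_qpoly exprMn exprS pm; ring. Qed.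

Lemma deriv_qpoly : qpoly^`() = (m.+1%:R / m%:R) *: (1%:P - 'X^m).
Proof.
rewrite derivB !derivZ derivX derivXn /= scalerBr alg_polyC; congr (_ - _).
by rewrite -scalerMnr scalerMnl -mulr_natl.
Qed.

Lemma horner_deriv_qpoly x :
  qpoly^`().[x] = m.+1%:R / m%:R * (1 - x ^+ m).
Proof. by rewrite deriv_qpoly !(hornerE, hornerXn). Qed.

Lemma horner_deriv2_qpoly1 : qpoly^`(2).[1] = - m.+1%:R.
Proof.
rewrite derivnS derivn1 deriv_qpoly derivZ derivB derivXn.
rewrite derivC sub0r hornerZ hornerN hornerMn hornerXn expr1n.
by rewrite mulrN divfK.
Qed.

Lemma qpoly_local : exists c C r : R,
  [/\ 0 < c, 1 <= C, 0 < r <= 1 & forall p, p ^+ m = 1 ->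
    [/\ cabs p = 1,
      forall x, cabs x <= 1 -> cabs (qpoly.[p + x] - p) <= C * cabs x ^+ 2,
      forall x, cabs x <= 1 -> cabs qpoly^`().[p + x] <= C * cabs x &
      forall x, cabs x <= r -> c * cabs x ^+ 2 <= cabs (qpoly.[p + x] - p)]].
Proof.
have [T [hT T0]] := poly_taylor2 qpoly 1.
have {}hT h : qpoly.[1 + h] - 1 = h ^+ 2 * T.[h].
  rewrite hT qpoly_fixed ?expr1n // horner_deriv_qpoly expr1n subrr.
  by ring.
have {}T0 : T.[0] != 0.
  apply: contra_eq_neq T0 => ->; rewrite mul0rn horner_deriv2_qpoly1.
  by rewrite eq_sym oppr_eq0 pnatr_eq0.
have [B B0 hB] := poly_bounded T; have [K K0 hK] := poly_lipschitz T.
have [D D0 hD] := poly_lipschitz (qpoly^`() \Po ('X + 1)).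
(* Here q(1 + h) - 1 = h^2 T(h) with T(0) nonzero. [B] bounds T, [D] is a Lipschitz constant of q'(1
   + x), which vanishes at 0, and the radius keeps |T(x)| above |T(0)| / 2. *)
exists (cabs T.[0] / 2), (1 + B + D), (Num.min 1 (cabs T.[0] / 2 / K)).
have t0 : 0 < cabs T.[0] / 2 by rewrite divr_gt0 ?cabs_gt0.
split => //.
- by rewrite -addrA lerDl addr_ge0 ?ltW.
- by rewrite lt_min ltr01 divr_gt0 // ge_min lexx.
move=> p pm.
have p1 : cabs p = 1.
  have /eqP := congr1 (@cabs R) pm; rewrite cabsX cabs1.
  by rewrite pexpr_eq1 ?cabs_ge0 // => /eqP.
have pn0 : p != 0 by rewrite -cabs_gt0 p1.
have xp (x : R[i]) : cabs (x / p) = cabs x by rewrite cabsM cabsV p1 invr1 mulr1.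
have pE x : p + x = p * (1 + x / p) by rewrite mulrDr mulr1 mulrCA divff ?mulr1.
have qE x : cabs (qpoly.[p + x] - p) = cabs x ^+ 2 * cabs T.[x / p].
  rewrite pE qpoly_equivariant // -[X in _ - X]mulr1 -mulrBr hT cabsM p1 mul1r.
  by rewrite (cabsM (_ ^+ 2)) cabsX xp.
split=> // x x1.
- rewrite qE mulrC ler_wpM2r ?sqr_ge0 //.
  by rewrite (le_trans (hB _ _)) ?xp // addrAC lerDr addr_ge0 // ltW.
- have -> : qpoly^`().[p + x] =
      (qpoly^`() \Po ('X + 1)).[x / p] - (qpoly^`() \Po ('X + 1)).[0].
    rewrite !horner_comp !hornerE !horner_deriv_qpoly pE exprMn pm [x / p + 1]addrC.
    by rewrite expr1n; ring.
  rewrite (le_trans (hD _ _ _ _)) ?xp ?cabs0 ?subr0 ?xp //.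
  by rewrite ler_wpM2r ?cabs_ge0 // lerDr addr_ge0 // ltW.
- move: x1; rewrite le_min ler_pdivlMr // => /andP[x1 x2].
  rewrite qE mulrC ler_wpM2l ?sqr_ge0 //.
  have := hK 0 (x / p); rewrite cabs0 sub0r cabsN xp => /(_ ler01 x1) h.
  have := cabsB T.[0] T.[x / p]; lra.
Qed.

(** X^m - 1 splits over the algebraically closed field [R[i]] and is separable, so the list of its
    roots has m distinct entries. *)
Lemma ex_roots_of_unity :
  exists ps : 'I_m -> R[i], injective ps /\ forall i, ps i ^+ m = 1.
Proof.
have [rs rsE] := closed_field_poly_normal ('X^m - 1 : {poly R[i]}).
rewrite lead_coefXnsubC // scale1r in rsE.
have urs : uniq rs.
  by rewrite -separable_prod_XsubC -rsE cyclotomic.separable_Xn_sub_1.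
have srs : size rs = m.
  have := congr1 (fun p : {poly R[i]} => size p) rsE.
  by rewrite size_prod_XsubC size_XnsubC // => -[].
exists (fun i => rs`_i); split => [i j /eqP|i].
  by rewrite nth_uniq ?srs ?ltn_ord // => /eqP /val_inj.
have : root ('X^m - 1) rs`_i by rewrite rsE root_prod_XsubC mem_nth // srs.
by rewrite /root !hornerE subr_eq0 => /eqP.
Qed.

End SuperattractingPolynomial.

(** * Connectedness by paths *)

Section Connectedness.
Variable R : realType.

Lemma path_cconnected n (U : set 'rV[R[i]]_n) :
  (forall x y, U x -> U y -> exists g : R -> 'rV[R[i]]_n,
    [/\ g 0 = x, g 1 = y, forall t, 0 <= t <= 1 -> U (g t) &
      forall t e, 0 < e -> exists2 d : R, 0 < d &
        forall s, `|s - t| < d -> vnorm (g s - g t) < e]) ->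
  cconnected U.
Proof.
move=> hU A B oA oB UAB UAB0.
have [UA|/existsNP[x /not_implyP[Ux Ax]]] := pselect (U `<=` A); first by left.
have [UB|/existsNP[y /not_implyP[Uy By]]] := pselect (U `<=` B); first by right.
have Bx : B x by have [] := UAB _ Ux.
have Ay : A y by have [] := UAB _ Uy.
have [g [g0 g1 gU gc]] := hU _ _ Ux Uy.
have og W : copen W -> open (g @^-1` W).
  move=> oW; rewrite openE => t Wt; have [e e0 he] := oW _ Wt.
  have [d d0 hd] := gc t e e0; apply/nbhs_ballP; exists d => // s.
  by rewrite -ball_normE /= distrC => /hd /he.
have gAB t : 0 <= t <= 1 -> ~ (A (g t) /\ B (g t)).
  move=> t01 [At Bt]; have : (U `&` A `&` B) (g t).
    by split => //; split => //; exact: gU.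
  by rewrite UAB0.
have I1 : 0 <= (1 : R) <= 1 by rewrite ?ler01 ?lexx.
have I0 : 0 <= (0 : R) <= 1 by rewrite ?ler01 ?lexx.
(* The preimage of A in the segment is nonempty, open and closed, closed because it is also the
   complement of the preimage of B. Being the whole segment, it would put x in A. *)
suff : `[0, 1]%classic `&` g @^-1` A = `[0, 1]%classic.
  move=> /seteqP[_ /(_ 0)] /=; rewrite in_itv /= => /(_ I0)[_].
  by rewrite g0 => /Ax.
apply: (@segment_connected R 0 1).
- by exists 1; split; rewrite /= ?in_itv // g1.
- by exists (g @^-1` A) => //; exact: og.
- exists (~` (g @^-1` B)); first by apply: open_closedC; exact: og.
  apply/seteqP; split => t [] /=; rewrite in_itv /= => t01 ht; split => //.
    by move=> Bt; exact: (gAB t).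
  by have [] := UAB _ (gU _ t01).
Qed.

End Connectedness.

(** * Limits of sequences with geometric increments *)

Section LimitEstimate.
Variable R : realType.

Lemma ex_div_exp2_lt (K e : R) : 0 < e ->
  exists N, forall l, (N <= l)%N -> K / 2 ^+ l < e.
Proof.
move=> e0; exists (Num.bound `|K / e|) => l Nl.
rewrite ltr_pdivrMr ?exprn_gt0 // -ltr_pdivrMl // mulrC.
apply: le_lt_trans (ler_norm _) _; apply: lt_le_trans (archi_boundP _) _ => //.
rewrite -natrX ler_nat (leq_trans Nl) //; exact/ltnW/ltn_expl.
Qed.

Lemma lim_dist_le (a : nat -> R) K j :
  (forall l, (j <= l)%N -> `|a l.+1 - a l| <= K / 2 ^+ l.+1) ->
  forall l, (j <= l)%N -> `|lim (a @ \oo) - a l| <= K / 2 ^+ l.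
Proof.
move=> ha.
(* The exact geometric partial sum makes the induction close; the subtracted term is dropped
   afterwards. *)
have hd l i : (j <= l)%N -> `|a (i + l)%N - a l| <= K / 2 ^+ l - K / 2 ^+ (i + l).
  move=> jl; elim: i => [|i IH]; first by rewrite add0n !subrr normr0.
  have := ha (i + l)%N (leq_trans jl (leq_addl _ _)); rewrite addSn exprS.
  have := ler_distD (a (i + l)%N) (a (i + l).+1) (a l).
  have -> : K / (2 * 2 ^+ (i + l)) = 2^-1 * (K / 2 ^+ (i + l)).
    by rewrite invfM mulrCA.
  move: IH; lra.
have K0 : 0 <= K.
  have := le_trans (normr_ge0 _) (ha j (leqnn j)).
  by rewrite pmulr_lge0 // invr_gt0 exprn_gt0.
have {}hd l i : (j <= l)%N -> (l <= i)%N -> `|a i - a l| <= K / 2 ^+ l.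
  move=> jl li; have := hd l (i - l)%N jl; rewrite subnK // => /le_trans; apply.
  by rewrite gerBl divr_ge0 // exprn_ge0.
have ca : cvg (a @ \oo).
  apply: cauchy_cvg; apply: cauchy_exP => e e0.
  have [N hN] := ex_div_exp2_lt K e0.
  exists (a (maxn N j)); exists (maxn N j) => // i /= Ni.
  rewrite -ball_normE /= distrC; apply: le_lt_trans (hN _ (leq_maxl N j)).
  by apply: hd => //; exact: leq_maxr.
move=> l jl; apply/ler_addgt0Pr => e e0.
have /cvgrPdist_lt/(_ e e0) [N _ hN] := ca.
have := hN (maxn N l) (leq_maxl _ _); have := hd l (maxn N l) jl (leq_maxr _ _).
have := ler_distD (a (maxn N l)) (lim (a @ \oo)) (a l); lra.
Qed.

End LimitEstimate.

(** * Non-autonomous basins *)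

Section Basin.
Variable R : realType.
Variables (n : nat) (i0 i1 : 'I_n).
Hypothesis i01 : i0 != i1.
Variables (q : {poly R[i]}) (eta : nat -> R).
Hypothesis eta_gt0 : forall j, 0 < eta j.

Local Notation V := 'rV[R[i]]_n.
Local Notation S := (tperm_mx i0 i1 : 'M[R[i]]_n).
Local Notation e_ j := (delta_mx ord0 j : V).

Let vnormS (z : V) : vnorm (z *m S) = vnorm z.
Proof.
rewrite -xcolE /vnorm (reindex_inj (@perm_inj _ (tperm i0 i1))).
by congr (Num.sqrt _); apply: eq_bigr => j _; rewrite mxE tpermK.
Qed.

Let SS : S *m S = 1%:M.
Proof. by rewrite /tperm_mx -perm_mxM tperm2 perm_mx1. Qed.

Let mulS (z : V) j : (z *m S) ord0 j = z ord0 (tperm i0 i1 j).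
Proof. by rewrite -xcolE mxE. Qed.

Let eS0 : e_ i0 *m S = e_ i1.
Proof.
apply/rowP => j; rewrite mulS !mxE eqxx /=; congr (_%:R).
by rewrite (canF_eq (tpermK _ _)) tpermL.
Qed.

Let eS1 : e_ i1 *m S = e_ i0.
Proof. by rewrite -eS0 -mulmxA SS mulmx1. Qed.

Definition step j : V -> V := shear ((eta j)%:C%C *: S) i0 q (e_ i0).

(** Coordinate 1 of the image is eta_j z_0, so z_0 = w_1 / eta_j; then q(z_0) can be subtracted from
    w_0 before dividing by eta_j. *)
Definition istep j : V -> V :=
  shear ((eta j)^-1%:C%C *: S) i1
    (- (eta j)^-1%:C%C *: (q \Po ((eta j)^-1%:C%C *: 'X))) (e_ i1).

Let etaC j : (eta j)%:C%C * (eta j)^-1%:C%C = 1 :> R[i].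
Proof. by rewrite -rmorphM /= divff // gt_eqF. Qed.

Lemma stepK j : cancel (step j) (istep j).
Proof.
move=> z; rewrite /istep /step /shear.
have -> : (z *m ((eta j)%:C%C *: S) + q.[z ord0 i0] *: e_ i0) ord0 i1 =
    (eta j)%:C%C * z ord0 i0.
  rewrite mxE -scalemxAr mxE mulS tpermR !mxE eqxx /= eq_sym (negPf i01).
  by rewrite mulr0 addr0.
rewrite mulmxDl -!scalemxAr -!scalemxAl -mulmxA SS mulmx1 eS0.
rewrite scalerA mulrC etaC scale1r hornerZ horner_comp hornerZ hornerX.
rewrite mulrA [_%:C%C * _%:C%C]mulrC etaC mul1r !scalerA -addrA -scalerDl.
by rewrite mulNr subrr scale0r addr0.
Qed.

Lemma istepK j : cancel (istep j) (step j).
Proof.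
move=> w; rewrite /istep /step /shear.
set P := - _ *: (q \Po _).
have -> : (w *m ((eta j)^-1%:C%C *: S) + P.[w ord0 i1] *: e_ i1) ord0 i0 =
    (eta j)^-1%:C%C * w ord0 i1.
  rewrite mxE -scalemxAr mxE mulS tpermL !mxE eqxx /= (negPf i01).
  by rewrite mulr0 addr0.
rewrite mulmxDl -!scalemxAr -!scalemxAl -mulmxA SS mulmx1 eS1.
rewrite scalerA etaC scale1r /P hornerZ horner_comp hornerZ hornerX.
rewrite !scalerA -addrA -scalerDl mulNr mulrN mulrA etaC mul1r.
by rewrite addNr scale0r addr0.
Qed.

Fixpoint orb j : V -> V := if j is j'.+1 then step j' \o orb j' else id.
Fixpoint iorb j : V -> V := if j is j'.+1 then iorb j' \o istep j' else id.

Lemma orbK j : cancel (orb j) (iorb j).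
Proof. by elim: j => //= j IH z; rewrite /= stepK IH. Qed.

Lemma iorbK j : cancel (iorb j) (orb j).
Proof. by elim: j => //= j IH z; rewrite /= IH istepK. Qed.

Let hol_id (U : set V) : holomorphic U id.
Proof. by move=> z _; exists 1%:M; exact: hasCderiv_id. Qed.

Lemma holomorphic_orb j U : holomorphic U (orb j).
Proof.
elim: j U => [|j IH] U; first exact: hol_id.
by apply: (@holomorphic_comp _ _ _ _ _ setT) => //; exact: holomorphic_shear.
Qed.

Lemma holomorphic_iorb j U : holomorphic U (iorb j).
Proof.
elim: j U => [|j IH] U; first exact: hol_id.
apply: (@holomorphic_comp _ _ _ _ _ setT) => //; exact: holomorphic_shear.
Qed.

(** * The trapping ball, its basin and the Kobayashi metric *)

Variables (p : R[i]) (c C r : R).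
Hypothesis p1 : cabs p = 1.
Hypothesis c_gt0 : 0 < c.
Hypothesis C_gt0 : 0 < C.
Hypotheses (r_gt0 : 0 < r) (r_le1 : r <= 1) (Cr : C * r <= 4^-1).
Hypothesis q_le : forall x, cabs x <= 1 -> cabs (q.[p + x] - p) <= C * cabs x ^+ 2.
Hypothesis dq_le : forall x, cabs x <= 1 -> cabs q^`().[p + x] <= C * cabs x.
Hypothesis q_ge : forall x, cabs x <= r -> c * cabs x ^+ 2 <= cabs (q.[p + x] - p).
Hypothesis eta_le : forall j, eta j <= r / 8.

Definition ctr : V := p *: e_ i0.
Definition trap : set V := [set z | vnorm (z - ctr) < r].

Let trap_lt z : trap z -> vnorm (z - ctr) < r. Proof. by []. Qed.

Let pos (z : V) : R[i] := z ord0 i0 - p.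

Let posE (z : V) : z ord0 i0 = p + pos z. Proof. by rewrite addrC subrK. Qed.

Let pos_le z : cabs (pos z) <= vnorm (z - ctr).
Proof.
by have := cabs_le_vnorm (z - ctr) i0; rewrite !mxE !eqxx mulr1.
Qed.

Let pos_trap z : trap z -> cabs (pos z) < r.
Proof. exact/le_lt_trans/pos_le. Qed.

Let pos_trap1 z : trap z -> cabs (pos z) <= 1.
Proof. by move=> /pos_trap /ltW /le_trans; apply. Qed.

(** The linear part contributes at most (r / 8) |z| with |z| <= |p| + r <= 2, and the polynomial
    part at most C r^2 <= r / 4. *)
Lemma step_trap j z : trap z -> vnorm (step j z - ctr) <= r / 2.
Proof.
move=> Tz; rewrite /step /shear -addrA -scalerBl posE.
rewrite (le_trans (vnormD _ _)) // -scalemxAr !vnormZ vnormS vnorm_delta mulr1.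
rewrite cabs_real gtr0_norm //.
have z2 : vnorm z <= 2.
  rewrite -(subrK ctr z) (le_trans (vnormD _ _)) // vnormZ p1 vnorm_delta mulr1.
  by have := trap_lt Tz; have := r_le1; lra.
have h1 : eta j * vnorm z <= r / 8 * 2 by rewrite ler_pM ?vnorm_ge0 // ltW.
have h2 := q_le (pos_trap1 Tz).
have h3 : C * cabs (pos z) ^+ 2 <= 4^-1 * r.
  rewrite expr2 mulrA ler_pM ?mulr_ge0 ?cabs_ge0 ?(ltW C_gt0) //.
    by rewrite (le_trans _ Cr) // ler_wpM2l ?(ltW C_gt0) // ltW // pos_trap.
  by rewrite ltW // pos_trap.
lra.
Qed.

(** The linear part and the derivative of q contribute at most 1/4 each, the latter because C r <=
    1/4. *)
Lemma dstep_trap j z (h : V) : trap z ->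
  vnorm (h *m dshear ((eta j)%:C%C *: S) i0 q (e_ i0) z) <= 2^-1 * vnorm h.
Proof.
move=> Tz; rewrite mul_dshear (le_trans (vnormD _ _)) //.
rewrite -scalemxAr !vnormZ vnormS vnorm_delta mulr1 cabs_real gtr0_norm // cabsM.
have h1 : eta j * vnorm h <= 4^-1 * vnorm h.
  rewrite ler_wpM2r ?vnorm_ge0 // (le_trans (eta_le j)) //; have := r_le1; lra.
have h2 : cabs q^`().[z ord0 i0] <= 4^-1.
  rewrite posE (le_trans (dq_le (pos_trap1 Tz))) // (le_trans _ Cr) //.
  by rewrite ler_wpM2l ?(ltW C_gt0) // ltW // pos_trap.
have h3 : cabs q^`().[z ord0 i0] * cabs (h ord0 i0) <= 4^-1 * vnorm h.
  by rewrite ler_pM ?cabs_ge0 // cabs_le_vnorm.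
lra.
Qed.

Definition level j : set V := orb j @^-1` trap.
Definition basin : set V := \bigcup_j level j.

Lemma level_step j : level j `<=` level j.+1.
Proof.
move=> z Tz; rewrite /level /trap /= (le_lt_trans (step_trap _ Tz)) //.
by rewrite ltr_pdivrMr // ltr_pMr // ltr1n.
Qed.

Lemma level_le j l : (j <= l)%N -> level j `<=` level l.
Proof.
by move=> /subnK <-; elim: (l - j)%N => // d IH z /IH; exact: level_step.
Qed.

Lemma copen_level j : copen (level j).
Proof. by apply: copen_preim; [exact: holomorphic_orb|exact: copen_ball]. Qed.

Lemma copen_basin : copen basin.
Proof.
move=> z [j _ /copen_level[d d0 hd]]; exists d => // w /hd hw.
by exists j.
Qed.

Lemma level_biholomorphic j : biholomorphic (level j) (@unit_ball R n).
Proof.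
have rC : (r%:C%C : R[i]) * r^-1%:C%C = 1 by rewrite -rmorphM /= divff // gt_eqF.
split; first exact: copen_level.
split.
  rewrite (_ : @unit_ball R n = [set z : V | vnorm (z - 0) < 1]).
    exact: copen_ball.
  by apply/seteqP; split => z /=; rewrite /unit_ball /= subr0.
pose toB (z : V) : V := z *m (r^-1%:C%C)%:M + - (r^-1%:C%C *: ctr).
pose ofB (z : V) : V := z *m (r%:C%C)%:M + ctr.
have toBE z : toB z = r^-1%:C%C *: (z - ctr).
  by rewrite /toB mul_mx_scalar scalerBr.
have ofBE z : ofB z = r%:C%C *: z + ctr by rewrite /ofB mul_mx_scalar.
exists (toB \o orb j), (iorb j \o ofB); split.
  apply: (@holomorphic_comp _ _ _ _ _ setT) => //; first exact: holomorphic_orb.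
  exact: holomorphic_affine.
split.
  apply: (@holomorphic_comp _ _ _ _ _ setT) => //; last exact: holomorphic_iorb.
  exact: holomorphic_affine.
split => [z Lz|w Bw] /=; rewrite ?iorbK ofBE toBE.
  split; last by rewrite scalerA rC scale1r subrK orbK.
  rewrite /unit_ball /= vnormZ cabs_real gtr0_norm ?invr_gt0 //.
  by rewrite mulrC ltr_pdivrMr // mul1r.
rewrite addrK scalerA mulrC rC scale1r; split => //.
rewrite /level /trap /= iorbK addrK vnormZ cabs_real gtr0_norm //.
by rewrite -[X in _ < X]mulr1 ltr_pM2l.
Qed.

Lemma ctr_trap : trap ctr.
Proof. by rewrite /trap /= subrr vnorm0. Qed.

(** The path is the pullback by [iorb j] of a straight segment in the convex set [trap]. *)
Lemma cconnected_level j : cconnected (level j).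
Proof.
apply: path_cconnected => x y Lx Ly.
pose s (t : R) : V := (1 - t)%:C%C *: orb j x + t%:C%C *: orb j y.
have sE t t' : s t - s t' = (t - t')%:C%C *: (orb j y - orb j x).
  by rewrite /s; apply/rowP => i; rewrite !mxE !rmorphB; ring.
exists (iorb j \o s); split.
- by rewrite /s /= subr0 scale1r scale0r addr0 orbK.
- by rewrite /s /= subrr scale1r scale0r add0r orbK.
- move=> t /andP[t0 t1]; rewrite /level /trap /= iorbK.
  have -> : s t - ctr = (1 - t)%:C%C *: (orb j x - ctr) + t%:C%C *: (orb j y - ctr).
    by rewrite /s; apply/rowP => i; rewrite !mxE !rmorphB; ring.
  rewrite (le_lt_trans (vnormD _ _)) // !vnormZ !cabs_real !ger0_norm ?subr_ge0 //.
  move: Lx Ly; rewrite /level /trap /=.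
  move: (vnorm _) (vnorm _) => Y X X1 Y1.
  have [->|tn0] := eqVneq t 0; first by rewrite subr0 mul1r mul0r addr0.
  have : t * Y < t * r by rewrite ltr_pM2l // lt_def tn0.
  have : (1 - t) * X <= (1 - t) * r by rewrite ler_wpM2l ?subr_ge0 // ltW.
  lra.
- move=> t e e0; have [L dL] := @holomorphic_iorb j setT (s t) I.
  have [d d0 hd] := hasCderiv_cont dL e0.
  have B0 : 0 < vnorm (orb j y - orb j x) + 1 by rewrite ltr_wpDl ?vnorm_ge0.
  exists (d / (vnorm (orb j y - orb j x) + 1)); first by rewrite divr_gt0.
  move=> t'; rewrite ltr_pdivlMr // => ht /=; apply: hd.
  rewrite sE vnormZ cabs_real; apply: le_lt_trans ht.
  by rewrite ler_wpM2l // lerDl.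
Qed.

(** Every level is connected and contains [ctr], so all levels lie on the side of the separation
    that contains level 0. *)
Lemma cdomain_basin : cdomain basin.
Proof.
split; first exact: copen_basin.
have L0 : level 0 ctr by exact: ctr_trap.
split; last by exists ctr, 0.
move=> A B oA oB UAB UAB0.
have lev j : level j `<=` A \/ level j `<=` B.
  apply: cconnected_level => //.
    by move=> z Lz; apply: UAB; exists j.
  apply/seteqP; split => // z [[Lz Az] Bz].
  by rewrite -UAB0; split => //; split => //; exists j.
have no z : A z -> B z -> ~ level 0 z.
  move=> Az Bz Lz; have : (basin `&` A `&` B) z by split => //; split => //; exists 0.
  by rewrite UAB0.
have [h0|h0] := lev 0.
  left=> z [j _ Lz]; have [|hB] := lev j; first exact.
  exfalso; apply: (no ctr) => //; first exact: h0.
  by apply: hB; exact: (level_le (leq0n j)).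
right=> z [j _ Lz]; have [hA|] := lev j; last exact.
exfalso; apply: (no ctr) => //; last exact: h0.
by apply: hA; exact: (level_le (leq0n j)).
Qed.

Lemma orb_deriv_decay m z (v : V) : level m z ->
  exists M : R, forall d, exists2 L, hasCderiv (orb (d + m)) z L &
    vnorm (v *m L) <= M / 2 ^+ d.
Proof.
move=> Lz; have [L0 dL0] := @holomorphic_orb m setT z I.
exists (vnorm (v *m L0)); elim=> [|d [L dL hL]].
  by exists L0 => //; rewrite expr0 divr1.
exists (L *m dshear ((eta (d + m))%:C%C *: S) i0 q (e_ i0) (orb (d + m) z)).
  by rewrite addSn; apply: hasCderiv_comp => //; exact: hasCderiv_shear.
have Tz : trap (orb (d + m) z) by exact: (level_le (leq_addl d m)).
rewrite mulmxA (le_trans (dstep_trap _ _ Tz)) //.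
by rewrite exprS invfM mulrCA ler_wpM2l.
Qed.

(** After many steps the image of [v / e] is shorter than r / 2, so an affine disc in that direction
    fits into the trap. Its pullback by [iorb] is a disc through z with derivative [v / e], and the
    metric is at most e. *)
Lemma kobayashi_basin z v : basin z -> kobayashi basin z v = 0%E.
Proof.
move=> [m _ Lz]; apply/eqP; rewrite eq_le; apply/andP; split; last first.
  by apply: le_ereal_inf_tmp => _ [s [s0 _] <-]; rewrite lee_fin invr_ge0 ltW.
apply/lee_addgt0Pr => e e0; rewrite add0e.
have [M hM] := orb_deriv_decay v Lz.
have [|N hN] := ex_div_exp2_lt (M / e) (e := r / 2); first by rewrite divr_gt0.
(* The time N + 1 instead of N guarantees one step taken inside the trap, so the orbit point is
   within r / 2 of the centre. *)
have {}hN := hN _ (leqnSn N).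
have [L dL hL] := hM N.+1.
have wr : vnorm (orb (N.+1 + m) z - ctr) <= r / 2.
  exact: (step_trap _ (level_le (leq_addl N m) Lz)).
move: (N.+1 + m)%N dL wr => l dL; set w := orb l z => wr.
pose W : V := e^-1%:C%C *: (v *m L).
have nW : vnorm W < r / 2.
  rewrite vnormZ cabs_real gtr0_norm ?invr_gt0 // (le_lt_trans _ hN) //.
  by rewrite mulrAC mulrC ler_wpM2r // invr_ge0 ltW.
pose f (x : 'rV[R[i]]_1) : V := iorb l (x *m W + w).
have [L' dL'] := @holomorphic_iorb l setT w I.
have LL' : L *m L' = 1%:M.
  apply: hasCderiv_uniq (hasCderiv_id z).
  by apply: eq_hasCderiv (hasCderiv_comp dL dL') => y; exact: orbK.
apply: ereal_inf_lbound; exists e^-1; last by rewrite invrK.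
split; first by rewrite invr_gt0.
exists f; split.
  apply: (@holomorphic_comp _ _ _ _ _ setT) => //; last exact: holomorphic_iorb.
  exact: holomorphic_affine.
split.
  move=> _ [x x1 <-]; exists l => //.
  rewrite /level /trap /= /f iorbK -addrA (le_lt_trans (vnormD _ _)) //.
  rewrite [x]mx11_scalar mul_scalar_mx vnormZ [r]splitr.
  apply: ltr_leD => //; apply: le_lt_trans nW; rewrite ler_piMl ?vnorm_ge0 //.
  by rewrite (le_trans (cabs_le_vnorm x ord0)) // ltW.
split; first by rewrite /f mul0mx add0r orbK.
have -> : e^-1%:C%C *: v = W *m L'.
  by rewrite -scalemxAl -mulmxA LL' mulmx1.
apply: (hasCderiv_comp (hasCderiv_affine W w 0)).
by rewrite mul0mx add0r.
Qed.

(** * The bounded plurisubharmonic function *)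

Variable delta : R.
Hypotheses (delta_gt0 : 0 < delta) (delta_lt1 : delta < 1).

Let dl j := delta ^+ (2 ^ j).

Hypothesis eta_dl : forall j, eta j <= dl j ^+ 2.
Hypothesis eta_c : forall j, eta j <= c / 2 * dl j ^+ 2.

Let dl_gt0 j : 0 < dl j. Proof. exact: exprn_gt0. Qed.

Let dlS j : dl j.+1 = dl j ^+ 2.
Proof. by rewrite /dl expnSr exprM. Qed.

(** The floor [dl j] keeps the logarithm finite, and it squares exactly from one index to the next,
    as the distance does up to constants. *)
Let mx j z := Num.max (cabs (pos (orb j z))) (dl j).

Let mx_gt0 j z : 0 < mx j z. Proof. by rewrite lt_max dl_gt0 orbT. Qed.

Definition green_const : R := `|ln (Num.min (c / 2) 1)| + `|ln (C + 1)|.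

Definition green_approx j (z : V) : R := ln (mx j z) / 2 ^+ j.

Definition green (z : V) : R := lim (green_approx ^~ z @ \oo).

Let posS j z : pos (orb j.+1 z) =
  (q.[p + pos (orb j z)] - p) + (eta j)%:C%C * orb j z ord0 i1.
Proof.
rewrite /pos /= /step /shear [in LHS]mxE -scalemxAr [in X in X + _ - _]mxE mulS tpermL.
by rewrite !mxE !eqxx mulr1 [p + _]addrC subrK; ring.
Qed.

Let coord1_le z : trap z -> cabs (z ord0 i1) <= 1.
Proof.
move=> Tz; apply: le_trans r_le1; apply: le_trans (ltW (trap_lt Tz)).
have := cabs_le_vnorm (z - ctr) i1.
by rewrite !mxE eq_sym (negPf i01) mulr0 subr0.
Qed.

(** Inside the trap coordinate 1 is at most 1, so the coupling term is at most eta_j. From above, C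
    x^2 + eta_j <= (C + 1) mx^2. From below, if x >= dl then c x^2 - eta_j >= (c / 2) x^2; otherwise
    the floor alone suffices. *)
Let mx_step j z : level j z ->
  Num.min (c / 2) 1 * mx j z ^+ 2 <= mx j.+1 z <= (C + 1) * mx j z ^+ 2.
Proof.
move=> Lz; have x1 := pos_trap1 Lz; have xr := ltW (pos_trap Lz).
set x := pos (orb j z) in x1 xr *.
have hE : cabs ((eta j)%:C%C * orb j z ord0 i1) <= eta j.
  rewrite cabsM cabs_real gtr0_norm // ler_piMr ?(ltW (eta_gt0 j)) //.
  exact: coord1_le.
have c20 : 0 < c / 2 by rewrite divr_gt0.
have dm : dl j ^+ 2 <= mx j z ^+ 2.
  rewrite ler_pXn2r ?nnegrE ?(ltW (dl_gt0 j)) ?(ltW (mx_gt0 j z)) //.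
  by rewrite le_max lexx orbT.
have xm : cabs x ^+ 2 <= mx j z ^+ 2.
  by rewrite ler_pXn2r ?nnegrE ?cabs_ge0 ?(ltW (mx_gt0 j z)) // le_max lexx.
apply/andP; split.
  have min1 : Num.min (c / 2) 1 <= 1 by rewrite ge_min lexx orbT.
  have minc : Num.min (c / 2) 1 <= c / 2 by rewrite ge_min lexx.
  rewrite le_max; have [dx|xd] := leP (dl j) (cabs x); apply/orP; [left|right].
    have -> : mx j z = cabs x by rewrite /mx -/x (max_idPl dx).
    rewrite posS -/x.
    have := cabsB_leD (q.[p + x] - p) ((eta j)%:C%C * orb j z ord0 i1).
    have := q_ge xr; have := eta_c j.
    have : c / 2 * dl j ^+ 2 <= c / 2 * cabs x ^+ 2.
      rewrite ler_wpM2l ?(ltW c20) //.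
      by rewrite ler_pXn2r ?nnegrE ?cabs_ge0 ?(ltW (dl_gt0 j)).
    have : Num.min (c / 2) 1 * cabs x ^+ 2 <= c / 2 * cabs x ^+ 2.
      by rewrite ler_wpM2r ?sqr_ge0.
    move: hE; lra.
  have -> : mx j z = dl j by rewrite /mx -/x (max_idPr (ltW xd)).
  by rewrite dlS ler_piMl ?sqr_ge0.
have C0 := ltW C_gt0; rewrite ge_max; apply/andP; split.
  rewrite posS -/x (le_trans (cabsD _ _)) //.
  have := q_le x1; have := eta_dl j.
  have : C * cabs x ^+ 2 <= C * mx j z ^+ 2 by rewrite ler_wpM2l.
  move: hE dm; lra.
rewrite dlS (le_trans dm) // mulrDl mul1r lerDr mulr_ge0 ?sqr_ge0 //.
Qed.

Let green_const_ge0 : 0 <= green_const.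
Proof. by rewrite addr_ge0. Qed.

Lemma green_approx_step j z : level j z ->
  `|green_approx j.+1 z - green_approx j z| <= green_const / 2 ^+ j.+1.
Proof.
move=> Lz; have /andP[lo up] := mx_step Lz.
have m2 : 0 < mx j z ^+ 2 by rewrite exprn_gt0.
have k0 : 0 < Num.min (c / 2) 1 by rewrite lt_min divr_gt0 ?ltr01.
have K0 : 0 < C + 1 by rewrite addr_gt0.
have -> : green_approx j.+1 z - green_approx j z =
    (ln (mx j.+1 z) - ln (mx j z) * 2) / 2 ^+ j.+1.
  rewrite /green_approx exprS mulrBl invfM; congr (_ - _).
  by rewrite mulrA mulfK.
rewrite normrM [`|_^-1|]ger0_norm ?invr_ge0 ?exprn_ge0 //.
rewrite ler_wpM2r ?invr_ge0 ?exprn_ge0 //.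
have h1 : ln (Num.min (c / 2) 1) + ln (mx j z) * 2 <= ln (mx j.+1 z).
  rewrite mulr_natr -lnXn // -lnM ?posrE // ler_ln ?posrE ?mulr_gt0 //.
have h2 : ln (mx j.+1 z) <= ln (C + 1) + ln (mx j z) * 2.
  rewrite mulr_natr -lnXn // -lnM ?posrE // ler_ln ?posrE ?mulr_gt0 //.
have := ler_norm (ln (C + 1)); have := normr_ge0 (ln (C + 1)).
have := lerNnormlW (lexx `|ln (Num.min (c / 2) 1)|).
have := normr_ge0 (ln (Num.min (c / 2) 1)).
rewrite ler_norml /green_const => ? ? ? ?; apply/andP; split; lra.
Qed.

Lemma green_dist j z l : level j z -> (j <= l)%N ->
  `|green z - green_approx l z| <= green_const / 2 ^+ l.
Proof.
move=> Lz; apply: (@lim_dist_le _ (green_approx ^~ z)) => i ji.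
exact/green_approx_step/(level_le ji).
Qed.

Lemma green_approx_cont j z e : 0 < e -> exists2 d : R, 0 < d &
  forall w, vnorm (w - z) < d -> `|green_approx j w - green_approx j z| < e.
Proof.
move=> e0; have e20 : 0 < e * 2 ^+ j by rewrite mulr_gt0 ?exprn_gt0.
have /cvgrPdist_lt/(_ _ e20)/nbhs_ballP[d1 d10 hd1] := continuous_ln (mx_gt0 j z).
have [L dL] := @holomorphic_orb j setT z I.
have [d d0 hd] := hasCderiv_cont dL d10.
exists d => // w /hd hw.
rewrite /green_approx -mulrBl normrM [`|_^-1|]ger0_norm ?invr_ge0 ?exprn_ge0 //.
rewrite ltr_pdivrMr ?exprn_gt0 // distrC; apply: hd1.
rewrite -ball_normE /= distrC (le_lt_trans (max_lipschitz _ _ _)) //.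
rewrite (le_lt_trans (cabs_dist_dist _ _)) // (le_lt_trans _ hw) //.
have -> : pos (orb j w) - pos (orb j z) = (orb j w - orb j z) ord0 i0.
  by rewrite /pos !mxE; ring.
exact: cabs_le_vnorm.
Qed.

(** On the open set [level j] the continuous approximations converge uniformly, so three terms of
    size e / 3 suffice. *)
Lemma green_cont z e : basin z -> 0 < e -> exists2 d : R, 0 < d &
  forall w, vnorm (w - z) < d -> `|green w - green z| < e.
Proof.
move=> [j _ Lz] e0; have e30 : 0 < e / 3 by rewrite divr_gt0.
have [N hN] := ex_div_exp2_lt green_const e30.
set l := maxn N j; have {}hN := hN l (leq_maxl _ _).
have jl : (j <= l)%N := leq_maxr _ _.
have [d1 d10 h1] := copen_level Lz.
have [d2 d20 h2] := green_approx_cont l z e30.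
exists (Num.min d1 d2); first by rewrite lt_min d10.
move=> w; rewrite lt_min => /andP[/h1 Lw /h2 hw].
have := green_dist Lw jl; have := green_dist Lz jl.
have := ler_distD (green_approx l w) (green w) (green z).
have := ler_distD (green_approx l z) (green_approx l w) (green z).
rewrite [`|green_approx l z - green z|]distrC; lra.
Qed.

(** This brings the one-variable inequality [log_max_submean] to bear on the restriction of
    [green_approx] to complex lines. *)
Lemma orb_line j (a b : V) i :
  exists Q : {poly R[i]}, forall x, orb j (a + x *: b) ord0 i = Q.[x].
Proof.
elim: j i => [|j IH] i.
  exists ((a ord0 i)%:P + b ord0 i *: 'X) => x.
  by rewrite !mxE !hornerE mulrC.
have [Q hQ] := IH (tperm i0 i1 i); have [Q0 hQ0] := IH i0.
exists ((eta j)%:C%C *: Q + e_ i0 ord0 i *: (q \Po Q0)) => x.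
rewrite /= /step /shear mxE -scalemxAr mxE mulS hQ mxE hQ0.
by rewrite !hornerE horner_comp mulrC [in RHS]mulrC; ring.
Qed.

Lemma circle_cont (a b : V) t e : 0 < e -> exists2 d : R, 0 < d &
  forall s, `|s - t| < d -> vnorm ((a + expi s *: b) - (a + expi t *: b)) < e.
Proof.
move=> e0; have b0 : 0 < vnorm b + 1 by rewrite ltr_wpDl ?vnorm_ge0.
have [|d d0 hd] := @expi_continuous R t (e / (vnorm b + 1)).
  by rewrite divr_gt0.
exists d => // s /hd; rewrite ltr_pdivlMr //; apply: le_lt_trans.
rewrite opprD addrACA subrr add0r -scalerBl vnormZ.
by rewrite ler_wpM2l ?cabs_ge0 // lerDl.
Qed.

(** The circle is compact and the open levels increase, so one level contains it together with its
    centre; [green_dist] is then uniform there. *)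
Lemma circle_level (a b : V) :
  (forall x, cabs x <= 1 -> basin (a + x *: b)) ->
  exists l, level l a /\ forall t, 0 <= t <= 2 * pi -> level l (a + expi t *: b).
Proof.
move=> hab; have [|j _ La] := hab 0; first by rewrite cabs0.
rewrite scale0r addr0 in La.
have /compact_near_coveringP cov := @segment_compact R 0 (2 * pi).
have [|N _ hN] := cov nat \oo (fun l t => level l (a + expi t *: b)) _.
  move=> t _; have [|l _ Ll] := hab (expi t); first by rewrite cabs_expi.
  have [d d0 hd] := copen_level Ll; have [d' d'0 hd'] := circle_cont a b t d0.
  exists (ball t d', [set l' | (l <= l')%N]) => /=.
    by split; [exact: nbhsx_ballx|exists l].
  move=> [s l'] [/= ts ll']; apply: (level_le ll'); apply/hd/hd'.
  by move: ts; rewrite -ball_normE /= distrC.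
exists (maxn N j); split; first exact: (level_le (leq_maxr _ _)).
by move=> t t2; apply: (hN _ (leq_maxl N j)); rewrite /= in_itv.
Qed.

Lemma green_submean (a b : V) :
  (forall x, cabs x <= 1 -> basin (a + x *: b)) ->
  continuous (fun t => green (a + expi t *: b)) /\
  green a * (2 * pi) <=
    \int[@lebesgue_measure R]_(t in `[0, 2 * pi]) green (a + expi t *: b).
Proof.
move=> hab; have pi20 : 0 < 2 * pi :> R by rewrite mulr_gt0 ?pi_gt0.
have cg : continuous (fun t => green (a + expi t *: b)).
  apply: continuous_eps => t e e0.
  have Bt : basin (a + expi t *: b) by apply: hab; rewrite cabs_expi.
  have [d d0 hd] := green_cont Bt e0; have [d' d'0 hd'] := circle_cont a b t d0.
  by exists d' => // s /hd' /hd.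
split=> //; have [l0 [La Lt]] := circle_level hab.
apply/ler_addgt0Pr => e e0.
(* The approximation error is paid twice, at the centre and on the circle, each time multiplied by 2
   pi. *)
have [N hN] := ex_div_exp2_lt (green_const * (2 * (2 * pi))) e0.
set l := maxn N l0; have {}hN := hN l (leq_maxl _ _).
have ll : (l0 <= l)%N := leq_maxr _ _.
have [Q hQ] := orb_line l a b i0.
pose P := Q - p%:P.
have mxE' x : mx l (a + x *: b) = Num.max (cabs P.[x]) (dl l).
  by rewrite /mx /pos hQ !hornerE.
have gaE : (fun t => green_approx l (a + expi t *: b)) =
    fun t => ln (Num.max (cabs P.[expi t]) (dl l)) / 2 ^+ l.
  by apply/funext => t; rewrite /green_approx mxE'.
have cP := @log_max_continuous R P _ (dl_gt0 l).
have cga : continuous (fun t => green_approx l (a + expi t *: b)).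
  by rewrite gaE => t; apply: cvgM; [exact: cP|exact: cvg_cst].
have h1 : green_approx l a * (2 * pi) <=
    \int[@lebesgue_measure R]_(t in `[0, 2 * pi])
      green_approx l (a + expi t *: b).
  have -> : green_approx l a = ln (Num.max (cabs P.[0]) (dl l)) / 2 ^+ l.
    by rewrite -mxE' scale0r addr0.
  rewrite gaE RintegralZr //; last exact: continuous_integrable.
  rewrite mulrAC ler_wpM2r ?invr_ge0 ?exprn_ge0 //.
  exact: log_max_submean.
have h2 : \int[@lebesgue_measure R]_(t in `[0, 2 * pi])
      green_approx l (a + expi t *: b) <=
    \int[@lebesgue_measure R]_(t in `[0, 2 * pi]) green (a + expi t *: b) + green_const / 2 ^+ l * (2 * pi).
  rewrite -Rintegral_circle_cst -Rintegral_circleD //; last exact: cst_continuous.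
  apply: le_Rintegral_circle => //.
    by move=> t; apply: cvgD; [exact: cg|exact: cvg_cst].
  move=> t /Lt /green_dist/(_ ll); rewrite distrC => /(le_trans (ler_norm _)).
  by rewrite lerBlDl.
have h3 : green a * (2 * pi) <=
    (green_approx l a + green_const / 2 ^+ l) * (2 * pi).
  rewrite ler_wpM2r ?(ltW pi20) // -lerBlDl.
  exact: le_trans (ler_norm _) (green_dist La ll).
have h4 : green_const * (2 * (2 * pi)) / 2 ^+ l =
    green_const / 2 ^+ l * (2 * pi) + green_const / 2 ^+ l * (2 * pi) by ring.
rewrite h4 in hN; rewrite mulrDl in h3; lra.
Qed.

Lemma psh_green : psh basin (EFin \o green).
Proof.
split; first by move=> z _; rewrite ltry.
split.
  move=> z Bz y /=; rewrite lte_fin => gy.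
  have [|d d0 hd] := green_cont Bz (e := y - green z); first by rewrite subr_gt0.
  exists d => // w _ /hd /(le_lt_trans (ler_norm _)).
  by rewrite ltrD2r lte_fin.
move=> a b /green_submean[cg hg].
rewrite /= -[X in (_ <= _ * X)%E]fineK; last first.
  by apply: integrable_fin_num => //; exact: continuous_integrable.
rewrite -EFinM lee_fin mulrC ler_pdivlMr ?mulr_gt0 ?pi_gt0 //.
Qed.

(** Once the orbit is trapped, both entries of the maximum are at most 1, so the approximation is at
    most 0. *)
Lemma green_le z : basin z -> green z <= green_const.
Proof.
move=> [j _ Lz]; have := le_trans (ler_norm _) (green_dist Lz (leqnn j)).
have m1 : ln (mx j z) <= 0.
  apply: ln_le0; rewrite ge_max; apply/andP; split; first exact: pos_trap1.
  by rewrite exprn_ile1 // ltW.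
have : green_approx j z <= 0 by rewrite pmulr_lle0 ?invr_gt0 ?exprn_gt0.
have : green_const / 2 ^+ j <= green_const.
  rewrite ler_pdivrMr ?exprn_gt0 // ler_peMr //.
  by rewrite exprn_ege1 // ler1n.
lra.
Qed.

Hypothesis delta_small : ln delta + green_const < ln (r / 2) - green_const.

(** At time 0 the approximation is log delta at the centre and at least log (r / 2) at distance r /
    2; passing to the limit moves each by at most [green_const], less than half of the gap. *)
Lemma green_nonconstant : exists z w, [/\ basin z, basin w & green z <> green w].
Proof.
pose w := ctr + (r / 2)%:C%C *: e_ i0.
have r20 : 0 < r / 2 by rewrite divr_gt0.
have Lc : level 0 ctr by exact: ctr_trap.
have Lw : level 0 w.
  rewrite /level /trap /= /w addrAC subrr add0r vnormZ vnorm_delta mulr1.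
  by rewrite cabs_real gtr0_norm // ltr_pdivrMr // ltr_pMr // ltr1n.
exists ctr, w; split; [by exists 0|by exists 0|] => gE.
have gc : green_approx 0 ctr = ln delta.
  rewrite /green_approx divr1 /mx /pos /dl !mxE !eqxx mulr1 subrr cabs0 expn0 expr1.
  by rewrite (max_idPr _) // ltW.
have gw : ln (r / 2) <= green_approx 0 w.
  rewrite /green_approx divr1 ler_ln ?posrE //.
  rewrite le_max /pos !mxE !eqxx !mulr1 [p + _]addrC addrK cabs_real gtr0_norm //.
  by rewrite lexx.
have := green_dist Lc (leqnn 0); have := green_dist Lw (leqnn 0).
rewrite divr1 !ler_norml gE => /andP[h1 h2] /andP[h3 h4].
have := delta_small; lra.
Qed.

Theorem short_C_basin : short_C basin.
Proof.
split; first exact: cdomain_basin.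
split.
  exists level; split; first exact: level_step.
  by split=> // j; exact: level_biholomorphic.
split; first exact: kobayashi_basin.
exists (EFin \o green); split; first exact: psh_green.
split.
  by exists green_const => z Bz; rewrite lee_fin; exact: green_le.
have [z [w [Bz Bw gzw]]] := green_nonconstant.
by exists z, w; split=> //; split=> // -[].
Qed.

End Basin.

(** * Choice of the constants and disjointness of the basins *)

Theorem theorem1p3 (R : realType) (k : nat) (hk : (3 <= k)%N) :
  exists Om : 'I_k.-1 -> set 'rV[R[i]]_k,
    (forall i, short_C (Om i)) /\
    (forall i j, i != j -> Om i `&` Om j = set0).
Proof.
have k1_gt0 : (0 < k.-1)%N by case: k hk => [|[]].
pose i0 := Ordinal (leq_trans (isT : (0 < 3)%N) hk).
pose i1 := Ordinal (leq_trans (isT : (1 < 3)%N) hk).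
have i01 : i0 != i1 by [].
have [ps [ps_inj psE]] := ex_roots_of_unity R k1_gt0.
have [c [C [r0 [c0 C1 /andP[r00 r01] hq]]]] := qpoly_local R k1_gt0.
set q := qpoly R k.-1 in hq.
have C0 : 0 < C by exact: lt_le_trans C1.
pose r := Num.min r0 (4^-1 / C).
have r_gt0 : 0 < r by rewrite lt_min r00 divr_gt0.
have rr0 : r <= r0 by rewrite ge_min lexx.
have r_le1 : r <= 1 by exact: le_trans r01.
have Cr : C * r <= 4^-1 by rewrite mulrC -ler_pdivlMr // ge_min lexx orbT.
(* Solves the gap condition [delta_small] with a margin of 1. *)
pose delta := expR (ln (r / 2) - green_const c C *+ 2 - 1).
have K0 : 0 <= green_const c C by rewrite addr_ge0.
have delta_gt0 : 0 < delta by exact: expR_gt0.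
have delta_lt1 : delta < 1.
  rewrite expR_lt1; have : ln (r / 2) <= 0 by apply: ln_le0; lra.
  by rewrite mulr2n; lra.
(* The three entries yield the three upper bounds on [eta]; the factor [d j] is at most 1. *)
pose kap := Num.min (Num.min 1 (c / 2)) (r / 8).
have kap0 : 0 < kap by rewrite !lt_min ltr01 !divr_gt0.
pose d j := (delta ^+ (2 ^ j)) ^+ 2.
have d0 j : 0 < d j by rewrite !exprn_gt0.
have d1 j : d j <= 1 by rewrite /d -exprM exprn_ile1 // ltW.
pose eta j := kap * d j.
have eta_gt0 j : 0 < eta j by rewrite mulr_gt0.
have eta_le j : eta j <= r / 8.
  by rewrite (le_trans (ler_piMr (ltW kap0) (d1 j))) // ge_min lexx orbT.
have eta_dl j : eta j <= d j.
  by rewrite /eta ler_piMl ?(ltW (d0 j)) // !ge_min lexx.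
have eta_c j : eta j <= c / 2 * d j.
  by rewrite ler_wpM2r ?(ltW (d0 j)) // !ge_min lexx orbT.
have q_le i x : cabs x <= 1 -> cabs (q.[ps i + x] - ps i) <= C * cabs x ^+ 2.
  by have [_ h _ _] := hq _ (psE i); exact: h.
have ps1 i : cabs (ps i) = 1 by have [] := hq _ (psE i).
exists (fun i => basin i0 i1 q eta (ps i) r); split => [i|i j ij].
  have [_ _ h2 h3] := hq _ (psE i).
  apply: (short_C_basin i01 eta_gt0 (ps1 i) c0 C0 r_gt0 r_le1 Cr (q_le i) h2 _
    eta_le delta_gt0 delta_lt1 eta_dl eta_c).
    by move=> x /le_trans /(_ rr0); exact: h3.
  by rewrite expRK mulr2n; lra.
apply/seteqP; split => // z [[l _ Ll] [l' _ Ll']].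
(* All basins belong to the same sequence of maps, so a common point can be followed up to a time at
   which its orbit lies in both traps. *)
have mono i' := @level_le R k i0 i1 q eta eta_gt0 (ps i') C r (ps1 i') C0 r_gt0
  r_le1 Cr (q_le i') eta_le.
have {Ll} := mono i _ _ (leq_maxl l l') _ Ll.
have {Ll'} := mono j _ _ (leq_maxr l l') _ Ll'.
rewrite /level /trap /=; set w := orb _ _ _ _ _ _.
have close i' : vnorm (w - ctr i0 (ps i')) < r -> cabs (w ord0 i0 - ps i') < r.
  apply: le_lt_trans; have := cabs_le_vnorm (w - ctr i0 (ps i')) i0.
  by rewrite !mxE !eqxx mulr1.
move=> /close hj /close hi.
pose x := ps j - ps i.
have xr : cabs x < r + r.
  have -> : x = (w ord0 i0 - ps i) - (w ord0 i0 - ps j) by rewrite /x; ring.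
  by rewrite (le_lt_trans (cabsBD _ _)) // ltrD.
have r4 : r <= 4^-1.
  by rewrite (le_trans _ Cr) // ler_peMl // ltW.
have x1 : cabs x <= 1 by lra.
have := q_le i x x1.
(* Since [ps j] is fixed by q, the quadratic estimate at [ps i] reads |x| <= C |x|^2. Hence 1 <= C
   |x| < 2 C r <= 1/2, a contradiction. *)
rewrite /x [ps i + _]addrC subrK qpoly_fixed // -/x => hx.
have x0 : 0 < cabs x.
  by rewrite cabs_gt0 subr_eq0; apply: contraNneq ij => /ps_inj ->.
have : 1 <= C * cabs x.
  by rewrite -(ler_pM2r x0) mul1r -mulrA -expr2.
have : C * cabs x < C * (r + r) by rewrite ltr_pM2l.
lra.
Qed.
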